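(* Let $\Sigma\subset\mathbb R^2$ be a damping set and let $M,a,b>0$ be such that $a|x|\le|y|\le b|x|$ for every $(x,y)\in\Sigma\setminus B(0,M)$. Assume moreover that: (a) $\Sigma\cap\Delta=\{(0,0)\}$, where $\Delta=\{(x,x):x\in\mathbb R\}$; and (b) there exists a function $q\in\mathcal C^1(\mathbb R_+,\mathbb R_+)$ with $q(0)=q'(0)=0$, $0<q(x)<x$, and $|q'(x)|<1$ for every $x>0$ such that, for every $(x,y)\in\Sigma\cap B(0,M)$, $|y|=q(|x|)$ or $|x|=q(|y|)$. Then, for every $p\in[1,+\infty]$ and every nontrivial solution $z$ in $\mathsf X_p$ of the wave equation associated with $\Sigma$, there exist positive constants $C_1,C_2$ such that, for every $t\ge0$, $$C_1Q^{[\lfloor t/2\rfloor]}(1)\le e_p(z)(t)\le C_2Q^{[\lfloor t/2\rfloor]}(1),$$ where $Q(x)=\frac1{\sqrt2}\left[2(q+\mathrm{Id})^{-1}(\sqrt2\,x)-\sqrt2\,x\right]$ for $x\in\mathbb R_+$.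
   Context: Notation: $\mathbb R_+=[0,+\infty)$, $R=\begin{pmatrix}\frac1{\sqrt2}&\frac1{\sqrt2}\\-\frac1{\sqrt2}&\frac1{\sqrt2}\end{pmatrix}$ and $R\Sigma=\{R\xi:\xi\in\Sigma\}$; $B(0,M)$ is the Euclidean ball of $\mathbb R^2$ centered at $0$ of radius $M$; $\mathrm{Id}$ is the identity ($q+\mathrm{Id}$ is an increasing bijection of $\mathbb R_+$); $Q^{[n]}$ is the $n$-th iterate of $Q$ ($Q^{[0]}=\mathrm{Id}$). $L^p_{\mathrm{loc}}(a,+\infty)$ is the set of measurable functions whose restriction to $(a,T)$ is in $L^p$ for every $T>a$. $W^{1,p}_*(0,1)=\{u\in L^p(0,1): u'\in L^p(0,1),\ u(0)=0\}$ and $\mathsf X_p=W^{1,p}_*(0,1)\times L^p(0,1)$, with norm $\|(u,v)\|_{\mathsf X_p}^p=2^{-p/2}\int_0^1(|u'+v|^p+|u'-v|^p)\,dx$ if $p<+\infty$ and $\|(u,v)\|_{\mathsf X_\infty}=\frac1{\sqrt2}\max(\|u'+v\|_{L^\infty(0,1)},\|u'-v\|_{L^\infty(0,1)})$. The wave equation associated with $\Sigma$ is: $z_{tt}=z_{xx}$ on $\mathbb R_+\times[0,1]$; $z(t,0)=0$ and $(z_t(t,1),-z_x(t,1))\in\Sigma$ for $t\in\mathbb R_+$; $z(0,x)=z_0(x)$, $z_t(0,x)=z_1(x)$ for $x\in[0,1]$. A (weak, global in time) solution in $\mathsf X_p$ with initial condition $(z_0,z_1)\in\mathsf X_p$ is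 a function $z:\mathbb R_+\times[0,1]\to\mathbb R$ for which there exist $f\in L^p_{\mathrm{loc}}(0,+\infty)$ and $g\in L^p_{\mathrm{loc}}(-1,+\infty)$ such that $z(t,x)=\frac1{\sqrt2}\int_0^{t+x}f+\frac1{\sqrt2}\int_0^{t-x}g$ for all $(t,x)\in\mathbb R_+\times[0,1]$, $z(t,0)=0$ and $(z_t(t,1),-z_x(t,1))\in\Sigma$ for a.e. $t\in\mathbb R_+$, and $z(0,x)=z_0(x)$, $z_t(0,x)=z_1(x)$ for a.e. $x\in[0,1]$; here $z_t(t,x)=\frac{f(t+x)+g(t-x)}{\sqrt2}$ and $z_x(t,x)=\frac{f(t+x)-g(t-x)}{\sqrt2}$. Set $e_p(z)(t)=\|(z(t,\cdot),z_t(t,\cdot))\|_{\mathsf X_p}$. Damping set: $\Sigma$ is a damping set if $(0,0)\in\Sigma$, $xy\ge0$ for every $(x,y)\in\Sigma$, and $R\Sigma$ contains the graph of a universally measurable function $\varphi:\mathbb R\to\mathbb R$ with linear growth ($|\varphi(x)|\le a|x|+b$ for some $a,b\ge0$). A set $M\subset\mathbb R$ is universally measurable if for every Borel probability measure $\nu$ on $\mathbb R$ there exist Borel sets $A\subset M\subset B$ with $\nu(B\setminus A)=0$; $\varphi$ is universally measurable if preimages of Borel sets are universally measurable. *)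

(* Defs.v *)
From HB Require Import structures.
From mathcomp Require Import all_boot all_order all_algebra.
From mathcomp Require Import all_classical all_reals all_analysis.

Set Implicit Arguments.
Unset Strict Implicit.
Unset Printing Implicit Defensive.

Import Order.TTheory GRing.Theory Num.Theory.
Import numFieldNormedType.Exports.

Local Open Scope classical_set_scope.
Local Open Scope ring_scope.

(* Extension by zero turns the library norm over the whole line into the
   L^p(D) norm. *)
Definition Lp_norm (R : realType) (D : set R) (p : \bar R) (f : R -> R)
    : \bar R :=
  'N[@lebesgue_measure R]_p [EFin \o (f \_ D)].

Definition Lp (R : realType) (D : set R) (p : \bar R) (f : R -> R) : Prop :=
  measurable_fun D f /\ (Lp_norm D p f < +oo)%E.

Definition Lp_loc (R : realType) (a : R) (p : \bar R) (f : R -> R) : Prop :=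
  measurable_fun `]a, +oo[%classic f /\
  forall T : R, a < T -> Lp `]a, T[%classic p f.

(* Oriented integral, equal to minus the integral over [b, a] when b < a. *)
Definition oriented_integral (R : realType) (f : R -> R) (a b : R) : R :=
  if a <= b then (\int[@lebesgue_measure R]_(x in `[a, b]) f x)%R
  else - (\int[@lebesgue_measure R]_(x in `[b, a]) f x)%R.

(* C^1 functions with compact support contained in (0,1), the test functions
   of Brezis' definition of W^{1,p}(0,1); C^infinity ones give the same weak
   derivatives. *)
Definition test_function (R : realType) (phi : R -> R) : Prop :=
  [/\ forall x : R, derivable phi x 1,
      continuous (derive1 phi : R -> R) &
      exists a b : R, [/\ 0 < a, b < 1 &
        forall x : R, ~ (a <= x <= b) -> phi x = 0]].

Definition is_weak_derivative (R : realType) (u w : R -> R) : Prop :=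
  [/\ locally_integrable `]0, 1[%classic u,
      locally_integrable `]0, 1[%classic w &
      forall phi : R -> R, test_function phi ->
        (\int[@lebesgue_measure R]_(x in `]0, 1[) (u x * derive1 phi x) =
         - \int[@lebesgue_measure R]_(x in `]0, 1[) (w x * phi x))%R].

(* A representative of u', unique up to a null subset of (0,1); the default
   value is only reached when u has no weak derivative. *)
Definition weak_derivative (R : realType) (u : R -> R) : R -> R :=
  xget (cst 0) [set w | is_weak_derivative u w].

(* The boundary value u(0) is that of the continuous representative of u. *)
Definition W1p_star (R : realType) (p : \bar R) (u : R -> R) : Prop :=
  [/\ Lp `]0, 1[%classic p u,
      exists w : R -> R, is_weak_derivative u w /\ Lp `]0, 1[%classic p w &
      exists v : R -> R, [/\ {within `[0, 1], continuous v},
        {ae @lebesgue_measure R, forall x, x \in `]0, 1[ -> u x = v x} &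
        v 0 = 0]].

Definition Xp (R : realType) (p : \bar R) (u v : R -> R) : Prop :=
  W1p_star p u /\ Lp `]0, 1[%classic p v.

Definition Xp_norm (R : realType) (p : \bar R) (u v : R -> R) : \bar R :=
  let I : set R := `]0, 1[%classic in
  let du := weak_derivative u in
  match p with
  | r%:E =>
      (((2 `^ (- (r / 2)))%R%:E *
        \int[lebesgue_measure]_(x in I)
          (`|du x + v x| `^ r + `|du x - v x| `^ r)%R%:E) `^ r^-1%R)%E
  | +oo%E =>
      (((Num.sqrt 2)^-1)%R%:E *
        maxe (Lp_norm I +oo (du \+ v)%R) (Lp_norm I +oo (du \- v)%R))%E
  | -oo%E => 0%E
  end.

(* The action on (x, y) of the matrix with rows (1, 1) / sqrt 2 and
   (-1, 1) / sqrt 2. *)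
Definition rot (R : realType) (w : R * R) : R * R :=
  (w.1 / Num.sqrt 2 + w.2 / Num.sqrt 2,
   - w.1 / Num.sqrt 2 + w.2 / Num.sqrt 2).

(* The open ball; the library's [ball] on R * R is the one of the sup norm. *)
Definition euclidean_ball (R : realType) (M : R) : set (R * R) :=
  [set w | Num.sqrt (w.1 ^+ 2 + w.2 ^+ 2) < M].

Definition universally_measurable_set (R : realType) (E : set R) : Prop :=
  forall nu : probability (measurableTypeR R) R,
    exists A B : set (measurableTypeR R),
      [/\ measurable A, measurable B, A `<=` E, E `<=` B &
          nu (B `\` A) = 0%E].

Definition universally_measurable_fun (R : realType) (phi : R -> R) : Prop :=
  forall B : set (measurableTypeR R), measurable B ->
    universally_measurable_set (phi @^-1` B).

Definition linear_growth (R : realType) (phi : R -> R) : Prop :=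
  exists a b : R, [/\ 0 <= a, 0 <= b & forall x : R, `|phi x| <= a * `|x| + b].

Definition damping_set (R : realType) (Sigma : set (R * R)) : Prop :=
  [/\ Sigma (0, 0),
      forall x y : R, Sigma (x, y) -> 0 <= x * y &
      exists phi : R -> R,
        [/\ universally_measurable_fun phi, linear_growth phi &
            forall x : R, (@rot R @` Sigma) (x, phi x)]].

Definition wave_profiles (R : realType) (p : \bar R) (z : R -> R -> R)
    (f g : R -> R) : Prop :=
  [/\ Lp_loc 0 p f, Lp_loc (-1) p g &
      forall t x : R, 0 <= t -> 0 <= x <= 1 ->
        z t x = (Num.sqrt 2)^-1 * oriented_integral f 0 (t + x) +
                (Num.sqrt 2)^-1 * oriented_integral g 0 (t - x)].

Definition dt_of_profiles (R : realType) (f g : R -> R) (t x : R) : R :=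
  (f (t + x) + g (t - x)) / Num.sqrt 2.

Definition dx_of_profiles (R : realType) (f g : R -> R) (t x : R) : R :=
  (f (t + x) - g (t - x)) / Num.sqrt 2.

(* Only the values of z on [0, +oo[ x [0, 1] are constrained. *)
Definition wave_solution (R : realType) (Sigma : set (R * R)) (p : \bar R)
    (z0 z1 : R -> R) (z : R -> R -> R) : Prop :=
  exists f g : R -> R,
    [/\ wave_profiles p z f g,
        {ae @lebesgue_measure R, forall t, 0 <= t ->
           z t 0 = 0 /\
           Sigma (dt_of_profiles f g t 1, - dx_of_profiles f g t 1)} &
        {ae @lebesgue_measure R, forall x, 0 <= x <= 1 ->
           z 0 x = z0 x /\ dt_of_profiles f g 0 x = z1 x}].

(* z_t is read off from profiles of z, which z determines almost
   everywhere. *)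
Definition time_derivative (R : realType) (p : \bar R) (z : R -> R -> R)
    : R -> R -> R :=
  let fg := xget (cst 0, cst 0)
    [set fg : (R -> R) * (R -> R) | wave_profiles p z fg.1 fg.2] in
  dt_of_profiles fg.1 fg.2.

Definition energy (R : realType) (p : \bar R) (z : R -> R -> R) (t : R)
    : \bar R :=
  Xp_norm p (z t) (time_derivative p z t).

Definition nontrivial (R : realType) (z : R -> R -> R) : Prop :=
  exists t x : R, [/\ 0 <= t, 0 <= x <= 1 & z t x != 0].

(* q is C^1 on [0, +oo[ with derivative dq, one-sided at 0. *)
Definition C1_half_line (R : realType) (q dq : R -> R) : Prop :=
  (forall x : R, 0 <= x ->
     (q y - q x) / (y - x) @[y --> within [set y | 0 <= y] x^'] --> dq x) /\
  {within `[0, +oo[, continuous dq}.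

Definition Qmap (R : realType) (q : R -> R) (x : R) : R :=
  (Num.sqrt 2)^-1 *
  (2 * 'pinv_(fun=> 0) `[0, +oo[%classic (fun y => q y + y) (Num.sqrt 2 * x)
   - Num.sqrt 2 * x).

(* Main.v *)
Require Import Defs.
From mathcomp Require Import all_boot all_order all_algebra.
From mathcomp Require Import all_classical all_reals all_analysis.
From mathcomp Require Import measurable_realfun ess_sup_inf.
From mathcomp Require Import ring lra.

Set Implicit Arguments.
Unset Strict Implicit.
Unset Printing Implicit Defensive.

Import Order.TTheory GRing.Theory Num.Theory.
Import numFieldNormedType.Exports.

Local Open Scope classical_set_scope.
Local Open Scope ring_scope.

(** Write the solution as the sum of two travelling waves, with profiles [f]
    and [g] along the characteristics. The fixed end [x = 0] forces [f = - g],
    and at the damped end [x = 1] the coordinates of the boundary point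
    [(z_t, - z_x)] in [Sigma], rotated by [rot], are [g (t - 1)] and
    [g (t + 1)]. So the wave equation is the one-dimensional iteration of the
    relation [rot @` Sigma] on the values [g s], [g (s + 2)], [g (s + 4)], and
    so on, for [s] in [(-1, 1)].

    Moduli suffice. Put [h = `|g s|] and [h' = `|g (s + 2)|]. As the
    coordinates of the boundary point have the same sign, [sqrt 2 * h] and
    [sqrt 2 * h'] are the sum and the absolute difference of their moduli. In
    the ball these moduli are [r] and [q r], so [h' = Qmap q h]; outside, the
    sector condition gives [h' <= l * h] with [l < 1]; and [h'] vanishes only
    with [h], because [Sigma] meets the diagonal only at the origin. This is
    [decay_step] ([Sigma_decay_step]).

    Orbits of such steps are compared with the reference orbit
    [b n = iter n (Qmap q) 1]. Two orbits of [Qmap q] differ by a bounded time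
    shift, and since [Qmap q] is tangent to the identity at 0, a time shift
    costs a bounded factor ([iterQ_compare]). For the upper bound the
    dependence on the start matters, since [g] is only in [L^p]: a start [h]
    needs a time of order at most [log h] to come below the threshold, during
    which it shrinks at least as fast as [l ^+ n], whereas the reference
    orbit, once close to 0, shrinks at most that fast; the outcome is
    [C * b n * (1 + h)] ([orbit_upper]). For the lower bound, an orbit caught
    in an interval [[e, N)] at some time stays above [c * b n]
    ([orbit_lower]); almost every nonzero orbit is caught in this way, so a
    set of positive measure is caught with the same [e] at the same time
    ([positive_core]).

    It remains to read the energy on [g]. The sum and the difference of [z_x]
    and [z_t] at time [t] are, up to sign, [sqrt 2] times a translate and a
    reflected translate of [g], so the energy is the [L^p] norm of [g] on
    [(t - 1, t + 1)] ([energy_window]). This requires that the profiles and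
    the weak derivative chosen in the definition of the energy are determined
    almost everywhere ([profiles_unique], [weak_derivative_unique]), and that
    primitives are weakly differentiable ([prim_is_weak_derivative]); the
    first two rest on Lebesgue differentiation, the third on Fubini. As [`|g|]
    decreases under the shift by 2, the window norm is nonincreasing in [t]
    ([Lp_norm_slide]), which reduces the estimates to even times
    ([window_asymptotics]). *)

(** * The nonlinear map and the boundary law near the origin *)

(** What the asymptotic analysis uses of [Qmap q]: near 0 it is tangent to the
    identity, away from 0 it shrinks its argument by a factor that is uniform on
    compact intervals. *)
Record decay_map (R : realType) (Q : R -> R) : Prop := DecayMap {
  decay_map0 : Q 0 = 0;
  decay_map_gt0 : forall h, 0 < h -> 0 < Q h;
  decay_map_homo : forall h k, 0 <= h -> h <= k -> Q h <= Q k;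
  decay_map_near0 : forall m, m < 1 ->
    exists2 d, 0 < d & forall h, 0 <= h -> h <= d -> m * h <= Q h;
  decay_map_gap : forall c d, 0 < c -> c <= d ->
    exists2 l, 0 < l < 1 & forall h, c <= h -> h <= d -> Q h <= l * h }.

Section NonlinearDecay.
Context (R : realType) (q dq : R -> R).
Hypothesis q_C1 : C1_half_line q dq.
Hypothesis q_ge0 : forall x : R, 0 <= x -> 0 <= q x.
Hypothesis q0 : q 0 = 0.
Hypothesis dq0 : dq 0 = 0.
Hypothesis q_lt : forall x : R, 0 < x -> 0 < q x < x.
Hypothesis dq_lt1 : forall x : R, 0 < x -> `|dq x| < 1.

Let Q := Qmap q.

Lemma C1_half_line_is_derive (x : R) : 0 < x -> is_derive x 1 q (dq x).
Proof.
move=> x0.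
have [+ _] := q_C1 => /(_ x (ltW x0)) /cvgrPdist_lt cq.
have lim : h^-1 *: (q (h *: (1 : R) + x) - q x) @[h --> 0^'] --> dq x.
  apply/cvgrPdist_lt => e e0.
  have /nbhs_ballP[d /= d0 dP] := cq e e0.
  near=> h.
  have h0 : h != 0 by near: h; exact: nbhs_dnbhs_neq.
  have hd : `|h| < Num.min d x.
    by near: h; apply: dnbhs0_lt; rewrite lt_min d0 x0.
  have /= := dP (h + x).
  rewrite lt_min in hd; move: hd => /andP[hd hx].
  rewrite addrK [h *: (1 : R)]mulr1 mulrC; apply.
  - by rewrite /ball /= opprD addrCA subrr addr0 normrN.
  - by rewrite -subr_eq0 addrK.
  - by have := ler_norm (- h); rewrite normrN; lra.
by split; [apply/cvg_ex; exists (dq x)|apply/cvg_lim => //; exact: Rhausdorff].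
Unshelve. all: by end_near. Qed.

(** By the mean value theorem [q] is a strict contraction, so that [id + q] and
    [id - q] are both strictly increasing. *)
Lemma q_contract (x y : R) : 0 <= x -> x < y -> `|q y - q x| < y - x.
Proof.
rewrite le_eqVlt => /predU1P[<-|x0] xy.
  rewrite q0 !subr0; have /andP[qy qyy] := q_lt xy.
  by rewrite gtr0_norm.
have der z : z \in `]x, y[ -> is_derive z 1 q (dq z).
  rewrite in_itv => /andP[xz _].
  by apply: C1_half_line_is_derive; exact: lt_trans xz.
have ct : {within `[x, y], continuous q}.
  apply: derivable_within_continuous => z; rewrite in_itv => /andP[xz _].
  have [//] : is_derive z 1 q (dq z).
  by apply: C1_half_line_is_derive; exact: lt_le_trans xz.
have [c] := MVT xy der ct.
rewrite in_itv => /andP[xc _] ->.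
rewrite normrM (gtr0_norm (x := y - x)) ?subr_gt0//.
rewrite -[ltRHS]mul1r ltr_pM2r ?subr_gt0//.
by apply: dq_lt1; exact: lt_trans xc.
Qed.

Lemma q_continuous : continuous (fun x : R => q `|x|).
Proof.
have lip (x y : R) : `|q `|y| - q `|x| | <= `|x - y|.
  have [xy|xy|->] := ltgtP `|x| `|y|; last by rewrite subrr normr0.
  - apply: le_trans (ltW (q_contract _ xy)) _ => //.
    by rewrite distrC; exact: lerB_dist.
  - rewrite distrC; apply: le_trans (ltW (q_contract _ xy)) _ => //.
    exact: lerB_dist.
move=> x; apply/cvgrPdist_lt => e e0; near=> y.
rewrite distrC; apply: le_lt_trans (lip _ _) _.
by near: y; apply/nbhs_ballP; exists e.
Unshelve. all: by end_near. Qed.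

Lemma q_small (e : R) : 0 < e ->
  exists2 d, 0 < d & forall x, 0 <= x -> x <= d -> q x <= e * x.
Proof.
move=> e0; have [+ _] := q_C1 => /(_ 0 (lexx 0)) /cvgrPdist_lt /(_ e e0).
move=> /nbhs_ballP[d /= d0 dP]; exists (d / 2); first by lra.
move=> x; rewrite le_eqVlt => /predU1P[<-|x0] xd; first by rewrite q0 mulr0.
have /= := dP x; rewrite q0 dq0 !subr0 sub0r normrN => H.
have {H} : `|q x / x| < e.
  apply: H; [|by rewrite gt_eqF|exact: ltW].
  by rewrite /ball /= sub0r normrN gtr0_norm//; lra.
rewrite normrM normfV (gtr0_norm x0) ltr_pdivrMr// => /ltW.
by apply: le_trans; exact: ler_norm.
Qed.

Let s2 : R := Num.sqrt 2.

Let s2_gt0 : 0 < s2. Proof. by rewrite sqrtr_gt0. Qed.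

Let s2s2 : s2 * s2 = 2. Proof. by rewrite -expr2 sqr_sqrtr. Qed.

(** The value [h] of the profile is parametrized by the larger coordinate [r]
    of the boundary point, which removes the inverse function from [Qmap]. *)
Lemma Qmap_param (r : R) : 0 <= r -> Q ((r + q r) / s2) = (r - q r) / s2.
Proof.
move=> r0; rewrite /Q /Qmap -/s2 mulrCA divff ?gt_eqF// mulr1.
have -> : r + q r = (fun y => q y + y) r by rewrite addrC.
rewrite pinvKV; first by rewrite mulrC; congr (_ / _); lra.
- move=> x y; rewrite !inE /= !in_itv /= !andbT => x0 y0 e.
  have [xy|xy|//] := ltgtP x y.
  + by have := q_contract x0 xy; rewrite ltr_norml => /andP[+ _]; lra.
  + by have := q_contract y0 xy; rewrite ltr_norml => /andP[+ _]; lra.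
- by rewrite inE /= in_itv /= andbT.
Qed.

(** The intermediate value theorem for [r + q r], which is at least [r]; [q] is
    continued evenly to make it continuous on the line. *)
Lemma param_surj (h : R) : 0 <= h ->
  exists2 r, 0 <= r & h = (r + q r) / s2.
Proof.
move=> h0.
have hs0 : 0 <= h * s2 by rewrite mulr_ge0// ltW.
have ct : {within `[0, h * s2], continuous (fun x : R => `|x| + q `|x|)}.
  apply: continuous_subspaceT => x; apply: cvgD; last exact: q_continuous.
  exact: norm_continuous.
have bd : Num.min (`|0 : R| + q `|0 : R|) (`|h * s2| + q `|h * s2|) <= h * s2
    <= Num.max (`|0 : R| + q `|0 : R|) (`|h * s2| + q `|h * s2|).
  rewrite normr0 q0 addr0 ger0_norm// ge_min le_max hs0 /= lerDl q_ge0//.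
  by rewrite orbT.
have [r] := IVT hs0 ct bd; rewrite in_itv /= => /andP[r0 _].
rewrite ger0_norm// => e; exists r => //; rewrite e -mulrA divff ?mulr1//.
exact: lt0r_neq0.
Qed.

Lemma Qmap_gt0 (h : R) : 0 < h -> 0 < Q h.
Proof.
move=> h0; have [r r0 e] := param_surj (ltW h0).
rewrite e Qmap_param// divr_gt0// subr_gt0.
move: r0 h0; rewrite le_eqVlt => /predU1P[r0|]; last by move=> /q_lt /andP[].
by rewrite e -r0 q0 addr0 mul0r ltxx.
Qed.

Lemma Qmap_homo (h k : R) : 0 <= h -> h <= k -> Q h <= Q k.
Proof.
move=> h0 hk; have [r r0 e] := param_surj h0.
have [s s0 e'] := param_surj (le_trans h0 hk).
move: hk; rewrite e e' !Qmap_param// !ler_pM2r ?invr_gt0// => hk.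
have [rs|sr|->//] := ltgtP r s.
  by have := q_contract r0 rs; rewrite ltr_norml => /andP[]; lra.
by have := q_contract s0 sr; rewrite ltr_norml => /andP[]; lra.
Qed.

(** As [q x / x] tends to 0, the quotient of [r - q r] by [r + q r] tends to 1:
    the decay is slower than every exponential. *)
Lemma Qmap_near0 (m : R) : m < 1 ->
  exists2 d, 0 < d & forall h, 0 <= h -> h <= d -> m * h <= Q h.
Proof.
move=> m1; pose e := (1 - m) / (1 + `|m|).
have m0 := normr_ge0 m.
have e0 : 0 < e by rewrite divr_gt0//; lra.
have [d d0 dP] := q_small e0; exists (d / s2); first by rewrite divr_gt0.
move=> h h0 hd; have [r r0 he] := param_surj h0.
have qr0 := q_ge0 r0.
have rd : r <= d.
  by move: hd; rewrite he ler_pM2r ?invr_gt0//; lra.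
rewrite he Qmap_param// mulrA ler_pM2r ?invr_gt0//.
have qr := dP _ r0 rd.
have : q r * (1 + `|m|) <= (1 - m) * r.
  apply: (le_trans (ler_wpM2r _ qr)); first by lra.
  by rewrite /e mulrAC mulfVK//; lra.
have : q r * m <= q r * `|m| by rewrite ler_wpM2l// ler_norm.
nra.
Qed.

(** Here [Q h = h - sqrt 2 * q r], and [q] has a positive minimum on a compact
    interval of positive numbers. *)
Lemma Qmap_gap (c d : R) : 0 < c -> c <= d ->
  exists2 l, 0 < l < 1 & forall h, c <= h -> h <= d -> Q h <= l * h.
Proof.
move=> c0 cd; have d0 : 0 < d by exact: lt_le_trans cd.
have cd' : c * s2 / 2 <= d * s2.
  have := mulr_gt0 d0 s2_gt0.
  have : c * s2 <= d * s2 by rewrite ler_pM2r.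
  lra.
have := mulr_gt0 c0 s2_gt0 => cs0.
have ct : {within `[c * s2 / 2, d * s2], continuous (fun x : R => q `|x|)}.
  by apply: continuous_subspaceT; exact: q_continuous.
have [x] := EVT_min cd' ct; rewrite in_itv /= => /andP[cx xd] xmin.
have x0 : 0 < x by lra.
have /andP[qx0 qxx] := q_lt x0.
rewrite (gtr0_norm x0) in xmin.
exists (1 - q x / (s2 * d)).
  rewrite ltrBlDr ltrDl divr_gt0 ?mulr_gt0// andbT subr_gt0.
  rewrite ltr_pdivrMr ?mulr_gt0// mul1r; lra.
move=> h ch hd; have h0 : 0 <= h by lra.
have [r r0 e] := param_surj h0.
have qr0 := q_ge0 r0.
have e2 : r + q r = h * s2 by rewrite e -mulrA mulVf ?mulr1// lt0r_neq0.
have qr : q r <= r.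
  by move: r0; rewrite le_eqVlt => /predU1P[<-|/q_lt/andP[_ /ltW]//]; rewrite q0.
have hs : c * s2 <= h * s2 by rewrite ler_pM2r.
have hs' : h * s2 <= d * s2 by rewrite ler_pM2r.
have := xmin r; rewrite in_itv /= (ger0_norm r0) => qxr.
have {}qxr : q x <= q r by apply: qxr; apply/andP; split; lra.
have -> : Q h = h - s2 * q r.
  rewrite [in LHS]e Qmap_param//.
  have -> : r - q r = s2 * (h - s2 * q r) by rewrite mulrBr mulrA s2s2; lra.
  by rewrite mulrAC divff ?mul1r// lt0r_neq0.
rewrite mulrBl mul1r lerD2l lerN2.
have -> : q x / (s2 * d) * h = (q x / s2) * (h / d).
  by rewrite invfM -!mulrA; congr (_ * (_ * _)); rewrite mulrC.
have hd1 : h / d <= 1 by rewrite ler_pdivrMr// mul1r.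
apply: (@le_trans _ _ (q x / s2)).
  by rewrite -[leRHS]mulr1 ler_wpM2l// divr_ge0 ?ltW.
rewrite ler_pdivrMr// mulrAC s2s2; lra.
Qed.

Lemma Qmap0 : Q 0 = 0.
Proof. by have := Qmap_param (lexx 0); rewrite q0 addr0 subr0 mul0r. Qed.

Lemma Qmap_decay_map : decay_map Q.
Proof.
exact: DecayMap Qmap0 Qmap_gt0 Qmap_homo Qmap_near0 Qmap_gap.
Qed.

End NonlinearDecay.

(** * Orbits of the decay law *)

(** One reflection at the damped boundary, seen on the modulus of the profile.
    The map [Q] is known to govern it only below the threshold [N]; above, where
    the boundary law leaves some freedom, only a fixed contraction remains. The
    last clause excludes extinction in finite time, which would destroy every
    lower bound. *)
Definition decay_step (R : realType) (Q : R -> R) (N l h h' : R) : Prop :=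
  [/\ h < N -> h' = Q h, N <= h -> h' <= l * h & 0 < h -> 0 < h'].

Section Orbits.
Context (R : realType) (Q : R -> R).
Hypothesis QP : decay_map Q.

Let Q0 := decay_map0 QP.
Let Q_gt0 := decay_map_gt0 QP.
Let Q_homo := decay_map_homo QP.
Let Q_near0 := decay_map_near0 QP.
Let Q_gap := decay_map_gap QP.

Lemma Q_ge0 (h : R) : 0 <= h -> 0 <= Q h.
Proof. by rewrite le_eqVlt => /predU1P[<-|/Q_gt0/ltW//]; rewrite Q0. Qed.

Lemma Q_lt (h : R) : 0 < h -> Q h < h.
Proof.
move=> h0; have [l /andP[_ l1] lP] := Q_gap h0 (lexx h).
by apply: le_lt_trans (lP _ _ _) _ => //; rewrite gtr_pMl.
Qed.

Lemma Q_le (h : R) : 0 <= h -> Q h <= h.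
Proof. by rewrite le_eqVlt => /predU1P[<-|/Q_lt/ltW//]; rewrite Q0. Qed.

Lemma iterQ_gt0 n (h : R) : 0 < h -> 0 < iter n Q h.
Proof. by move=> h0; elim: n => //= n; exact: Q_gt0. Qed.

Lemma iterQ_ge0 n (h : R) : 0 <= h -> 0 <= iter n Q h.
Proof. by move=> h0; elim: n => //= n; exact: Q_ge0. Qed.

Lemma iterQ_homo n (h k : R) : 0 <= h -> h <= k -> iter n Q h <= iter n Q k.
Proof.
by move=> h0 hk; elim: n => //= n; apply: Q_homo; exact: iterQ_ge0.
Qed.

Lemma iterQ_le n (h : R) : 0 <= h -> iter n Q h <= h.
Proof.
move=> h0; elim: n => //= n; apply: le_trans.
by apply: Q_le; exact: iterQ_ge0.
Qed.

(** Near 0 this is the flatness of [Q]; away from 0 it is monotonicity. *)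
Lemma Q_ratio (d : R) : 0 < d ->
  exists2 m, 0 < m & forall h, 0 <= h -> h <= d -> m * h <= Q h.
Proof.
move=> d0; have [] := @Q_near0 (1 / 2); first by lra.
move=> e e0 eP; exists (Num.min (1 / 2) (Q e / d)).
  by rewrite lt_min; apply/andP; split; [lra|rewrite divr_gt0 ?Q_gt0].
move=> h h0 hd; have [he|eh] := leP h e.
  by apply: le_trans (eP _ h0 he); rewrite ler_wpM2r// ge_min lexx.
apply: le_trans (Q_homo (ltW e0) (ltW eh)).
apply: (@le_trans _ _ (Q e / d * h)).
  by rewrite ler_wpM2r// ge_min lexx orbT.
by rewrite mulrAC ler_pdivrMr// ler_wpM2l// ltW// Q_gt0.
Qed.

Lemma iterQ_small (x y : R) : 0 < x -> 0 < y -> exists k, iter k Q y <= x.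
Proof.
move=> x0 y0; have [yx|xy] := leP y x; first by exists 0%N.
have [l /andP[l0 l1] lP] := Q_gap x0 (ltW xy).
apply: contrapT => /forallNP H.
have big k : x < iter k Q y by rewrite ltNge; apply/negP; exact: H.
have geo k : iter k Q y <= l ^+ k * y.
  elim: k => [|k IH]; first by rewrite expr0 mul1r.
  rewrite iterS; apply: le_trans (lP _ (ltW (big k)) (iterQ_le _ (ltW y0))) _.
  by rewrite exprS -mulrA ler_pM2l.
have /cvgrPdist_lt/(_ (x / y)) : (GRing.exp l : R^nat) @ \oo --> (0 : R).
  by apply: cvg_expr; rewrite gtr0_norm.
rewrite divr_gt0// => /(_ isT)[k _ /(_ k (leqnn k))] /=.
rewrite sub0r normrN gtr0_norm ?exprn_gt0// ltr_pdivlMr// => lk.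
by have := le_lt_trans (geo k) lk; rewrite ltNge (ltW (big k)).
Qed.

(** Two orbits differ by a bounded time shift, and a time shift costs a bounded
    factor. *)
Lemma iterQ_compare (x y : R) : 0 < x -> 0 < y ->
  exists2 c, 0 < c & forall n, c * iter n Q y <= iter n Q x.
Proof.
move=> x0 y0; have [k ky] := iterQ_small x0 y0.
have [m m0 mP] := Q_ratio y0; exists (m ^+ k); first by rewrite exprn_gt0.
move=> n; apply: le_trans (iterQ_homo n (iterQ_ge0 k (ltW y0)) ky).
rewrite -iterD addnC.
elim: {x0 ky} k => [|k IH]; first by rewrite expr0 mul1r.
rewrite exprS -mulrA iterS; apply: le_trans (mP _ _ _); last 2 first.
- exact/iterQ_ge0/ltW.
- exact/iterQ_le/ltW.
by rewrite ler_pM2l.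
Qed.

Context (N l : R).
Hypothesis N_gt0 : 0 < N.
Hypothesis l_gt0 : 0 < l.
Hypothesis l_lt1 : l < 1.

Local Notation step := (decay_step Q N l).
Local Notation b n := (iter n Q 1).

Lemma decay_step_le (h h' : R) : 0 <= h -> step h h' -> h' <= h.
Proof.
move=> h0 [lo hi _]; have [/lo ->|/hi/le_trans->//] := ltP h N.
  exact: Q_le.
by rewrite -[leRHS]mul1r ler_wpM2r// ltW.
Qed.

Lemma orbit_le (h : nat -> R) : (forall n, 0 <= h n) ->
  (forall n, step (h n) (h n.+1)) -> forall n k, h (n + k)%N <= h n.
Proof.
move=> h0 hS n; elim=> [|k IH]; first by rewrite addn0.
by rewrite addnS; apply: le_trans IH; exact: decay_step_le.
Qed.

Lemma orbit_iter (h : nat -> R) : (forall n, 0 <= h n) ->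
  (forall n, step (h n) (h n.+1)) ->
  forall k, h k < N -> forall n, h (k + n)%N = iter n Q (h k).
Proof.
move=> h0 hS k hkN; elim=> [|n IH]; first by rewrite addn0.
rewrite addnS iterS -IH; have [+ _ _] := hS (k + n)%N; apply.
exact: le_lt_trans (orbit_le h0 hS _ _) hkN.
Qed.

Lemma orbit_below (h : nat -> R) : (forall n, 0 <= h n) ->
  (forall n, step (h n) (h n.+1)) -> exists k, h k < N.
Proof.
move=> h0 hS; apply: contrapT => /forallNP H.
have big k : N <= h k by rewrite leNgt; apply/negP; exact: H.
have h00 : 0 < h 0 by exact: lt_le_trans (big _).
have geo k : h k <= l ^+ k * h 0.
  elim: k => [|k IH]; first by rewrite expr0 mul1r.
  have [_ /(_ (big k)) hk _] := hS k; apply: le_trans hk _.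
  by rewrite exprS -mulrA ler_pM2l.
have /cvgrPdist_lt/(_ (N / h 0)) : (GRing.exp l : R^nat) @ \oo --> (0 : R).
  by apply: cvg_expr; rewrite gtr0_norm.
rewrite divr_gt0// => /(_ isT)[k _ /(_ k (leqnn k))] /=.
rewrite sub0r normrN gtr0_norm ?exprn_gt0// ltr_pdivlMr// => lk.
by have := le_lt_trans (geo k) lk; rewrite ltNge big.
Qed.

(** The bound is linear in [h 0], which is what an [L^p] estimate needs: above
    the threshold the orbit shrinks at least as fast as [l], while the reference
    orbit, once started where [Q h >= l * h], shrinks at most that fast. *)
Lemma orbit_upper : exists2 C, 0 < C &
  forall h : nat -> R, (forall n, 0 <= h n) ->
    (forall n, step (h n) (h n.+1)) ->
    forall n, h n <= C * b n * (1 + h 0).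
Proof.
have [d d0 dP] := Q_near0 l_lt1.
have [c1 c10 c1P] := iterQ_compare d0 N_gt0.
have [c2 c20 c2P] := iterQ_compare ltr01 d0.
pose be n := iter n Q d.
have be0 n : 0 < be n by exact: iterQ_gt0.
have beS n : l * be n <= be n.+1.
  by rewrite /be iterS; apply: dP; [exact/iterQ_ge0/ltW|exact/iterQ_le/ltW].
(* The first term of [K] serves at time 0, the second one for orbits that
   start below the threshold. *)
pose K := Num.max d^-1 (c1 * l * N)^-1.
have K0 : 0 < K by rewrite lt_max invr_gt0 d0.
have main n : forall h : nat -> R, (forall n, 0 <= h n) ->
    (forall n, step (h n) (h n.+1)) ->
    h n <= K * be n * Num.max (h 0) (l * N).
  elim: n => [|n IH] h h0 hS.
    have -> : be 0 = d by [].
    apply: (@le_trans _ _ (1 * h 0)); first by rewrite mul1r.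
    apply: ler_pM => //; last by rewrite le_max lexx.
    have : d^-1 * d <= K * d by rewrite ler_pM2r// le_max lexx.
    by rewrite mulVf// lt0r_neq0.
  have [hN|Nh] := ltP (h 0) N.
    have := orbit_iter h0 hS hN n.+1; rewrite add0n => ->.
    apply: le_trans (iterQ_homo n.+1 (h0 0) (ltW hN)) _.
    apply: (@le_trans _ _ (K * be n.+1 * (l * N))); last first.
      by rewrite ler_wpM2l ?le_max ?lexx ?orbT// mulr_ge0// ltW.
    have cc : 0 < c1 * l * N by rewrite !mulr_gt0.
    have H : 1 <= K * (c1 * l * N).
      have : (c1 * l * N)^-1 * (c1 * l * N) <= K * (c1 * l * N).
        by rewrite ler_pM2r// le_max lexx orbT.
      by rewrite mulVf// lt0r_neq0.
    have iN0 := iterQ_ge0 n.+1 (ltW N_gt0).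
    apply: le_trans (_ : K * (c1 * l * N) * iter n.+1 Q N <= _).
      by rewrite -[leLHS]mul1r ler_wpM2r.
    have -> : K * (c1 * l * N) * iter n.+1 Q N =
      (K * (l * N)) * (c1 * iter n.+1 Q N) by ring.
    have -> : K * be n.+1 * (l * N) = (K * (l * N)) * be n.+1 by ring.
    by rewrite ler_pM2l ?mulr_gt0//; exact: c1P.
  have := IH (fun k => h k.+1) (fun k => h0 k.+1) (fun k => hS k.+1).
  move=> /le_trans; apply.
  have [_ /(_ Nh) h1 _] := hS 0%N.
  have h00 : 0 < h 0 by exact: lt_le_trans Nh.
  apply: (@le_trans _ _ (K * be n * (l * h 0))).
    rewrite ler_wpM2l ?(mulr_ge0 (ltW _) (ltW _))// ge_max h1/=.
    by rewrite ler_pM2l.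
  apply: (@le_trans _ _ (K * be n.+1 * h 0)).
    have -> : K * be n * (l * h 0) = K * (l * be n) * h 0 by ring.
    by rewrite ler_pM2r// ler_pM2l.
  by rewrite ler_wpM2l ?le_max ?lexx// mulr_ge0// ltW.
exists (K / c2 * (1 + l * N)) => [|h h0 hS n].
  by rewrite mulr_gt0 ?divr_gt0// addr_gt0// mulr_gt0.
apply: le_trans (main n h h0 hS) _.
have -> : K / c2 * (1 + l * N) * b n * (1 + h 0) =
  K * (b n / c2) * ((1 + l * N) * (1 + h 0)) by ring.
have lN : 0 < l * N by rewrite mulr_gt0.
have h00 := h0 0%N.
apply: ler_pM.
- by rewrite mulr_ge0 ?ltW.
- by rewrite le_max h00.
- by rewrite ler_pM2l// ler_pdivlMr// mulrC; exact: c2P.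
- by rewrite ge_max; apply/andP; split; nra.
Qed.

(** Below the threshold the orbit is an orbit of [Q], comparable with the
    reference one; until it gets there it only decreases. *)
Lemma orbit_lower (e : R) : 0 < e -> exists2 c, 0 < c &
  forall h : nat -> R, (forall n, 0 <= h n) ->
    (forall n, step (h n) (h n.+1)) ->
    forall k, e <= h k -> h k < N -> forall n, c * b n <= h n.
Proof.
move=> e0; have [c c0 cP] := iterQ_compare e0 ltr01.
have m0 : 0 < Num.min e c by rewrite lt_min e0.
exists (Num.min e c) => // h h0 hS k ek kN n.
have b0 m : 0 < b m by exact: iterQ_gt0.
have [nk|kn] := leqP n k.
  apply: (@le_trans _ _ (h k)); last first.
    by rewrite -(subnKC nk); exact: orbit_le.
  apply: le_trans ek; rewrite -[leRHS]mulr1.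
  apply: ler_pM; first exact: ltW.
  - exact/ltW.
  - by rewrite ge_min lexx.
  - exact: (iterQ_le _ ler01).
rewrite -(subnKC (ltnW kn)) (orbit_iter h0 hS kN).
apply: le_trans (iterQ_homo _ (ltW e0) ek).
apply: le_trans (cP _).
apply: ler_pM; first exact: ltW.
- exact/ltW.
- by rewrite ge_min lexx orbT.
- rewrite addnC iterD; apply: iterQ_homo; first exact/iterQ_ge0.
  exact: iterQ_le.
Qed.

Lemma iterQ_next : exists2 c, 0 < c & forall n, c * b n <= b n.+1.
Proof.
have [m m0 mP] := Q_ratio ltr01; exists m => // n.
by rewrite iterS; apply: mP; [exact/iterQ_ge0|exact/iterQ_le].
Qed.

End Orbits.

(** * One reflection at the damped boundary *)

Section BoundaryStep.
Context (R : realType) (Sigma : set (R * R)) (M a b : R) (q dq : R -> R).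
Hypothesis Sigma_sign : forall x y : R, Sigma (x, y) -> 0 <= x * y.
Hypothesis M_gt0 : 0 < M.
Hypothesis a_gt0 : 0 < a.
Hypothesis b_gt0 : 0 < b.
Hypothesis Sigma_sector :
  forall x y : R, Sigma (x, y) -> ~ euclidean_ball M (x, y) ->
    a * `|x| <= `|y| <= b * `|x|.
Hypothesis Sigma_diag :
  Sigma `&` [set w : R * R | w.1 = w.2] = [set (0, 0)].
Hypothesis q_C1 : C1_half_line q dq.
Hypothesis q_ge0 : forall x : R, 0 <= x -> 0 <= q x.
Hypothesis q0 : q 0 = 0.
Hypothesis q_lt : forall x : R, 0 < x -> 0 < q x < x.
Hypothesis dq_lt1 : forall x : R, 0 < x -> `|dq x| < 1.
Hypothesis Sigma_q : forall x y : R, Sigma (x, y) -> euclidean_ball M (x, y) ->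
  `|y| = q `|x| \/ `|x| = q `|y|.

Let s2 : R := Num.sqrt 2.

Let s2_gt0 : 0 < s2. Proof. by rewrite sqrtr_gt0. Qed.

Lemma norm_add_same_sign (x y : R) : 0 <= x * y -> `|x + y| = `|x| + `|y|.
Proof.
move=> xy; apply/le_anti; rewrite ler_normD /=.
by case: (ger0P x) => x0; case: (ger0P y) => y0;
  case: (ger0P (x + y)) => s0; nra.
Qed.

Lemma norm_sub_same_sign (x y : R) : 0 <= x * y ->
  `|y - x| = `| `|x| - `|y| |.
Proof.
move=> xy; apply/le_anti; rewrite (distrC y) ler_dist_dist andbT.
rewrite -ler_sqr ?nnegrE// !real_normK ?num_real//.
by case: (ger0P x) => x0; case: (ger0P y) => y0; nra.
Qed.

(** As [x] and [y] have the same sign, [`|x + y|] and [`|y - x|] are the sum and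
    the difference of their moduli [r] and [q r]. *)
Lemma Sigma_Qmap (x y : R) : Sigma (x, y) -> euclidean_ball M (x, y) ->
  `|y - x| / s2 = Qmap q (`|x + y| / s2).
Proof.
move=> Sxy Bxy; have xy := Sigma_sign Sxy.
rewrite norm_sub_same_sign// norm_add_same_sign//.
have qle r : 0 <= r -> q r <= r.
  by rewrite le_eqVlt => /predU1P[<-|/q_lt/andP[_ /ltW]//]; rewrite q0.
case: (Sigma_q Sxy Bxy) => ->.
  rewrite (Qmap_param q_C1 q0 q_lt dq_lt1)// ger0_norm// subr_ge0.
  exact: qle.
rewrite (addrC _ `|y|) (Qmap_param q_C1 q0 q_lt dq_lt1)// distrC.
rewrite ger0_norm// subr_ge0.
exact: qle.
Qed.

(** Below the threshold the point is in the ball, since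
    [x ^+ 2 + y ^+ 2 <= (x + y) ^+ 2]. Above it, the point is either in the ball,
    where [Qmap q] contracts because its argument stays in a compact interval, or
    in the sector, where the moduli of [x] and [y] are comparable. Extinction
    would put the point on the diagonal. *)
Lemma Sigma_decay_step : exists2 l, 0 < l < 1 & forall x y : R, Sigma (x, y) ->
  decay_step (Qmap q) (M / s2) l (`|x + y| / s2) (`|y - x| / s2).
Proof.
have [M0 a0 b0] := And3 M_gt0 a_gt0 b_gt0.
have MN : M / s2 <= 2 * M.
  rewrite ler_pdivrMr//; have : 1 <= s2.
    by rewrite -sqrtr1 ler_sqrt//; lra.
  by move=> s21; nra.
have MN0 : 0 < M / s2 by rewrite divr_gt0.
have [l /andP[l0 l1] lP] := Qmap_gap q_C1 q_ge0 q0 q_lt dq_lt1 MN0 MN.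
(* In the sector, each of the two moduli is at least [c] times the other. *)
pose c := Num.min 1 (Num.min a b^-1).
have c0 : 0 < c by rewrite !lt_min a_gt0 invr_gt0 b_gt0 ltr01.
have c1 : c <= 1 by rewrite ge_min lexx.
have ca : c <= a by rewrite !ge_min lexx orbT.
have cb : c * b <= 1.
  by rewrite -ler_pdivlMr// mul1r !ge_min lexx !orbT.
exists (Num.max l (1 - c / 2)).
  by rewrite lt_max gt_max l0 l1 /=; lra.
move=> x y Sxy; have xy := Sigma_sign Sxy.
have inball : `|x + y| / s2 < M / s2 -> euclidean_ball M (x, y).
  rewrite ltr_pM2r ?invr_gt0// /euclidean_ball /= => xyM.
  rewrite -(gtr0_norm M_gt0) -sqrtr_sqr ltr_sqrt ?exprn_gt0//.
  apply: (@le_lt_trans _ _ (`|x + y| ^+ 2)); last first.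
    by rewrite ltr_sqr ?nnegrE// ltW.
  by rewrite real_normK ?num_real//; nra.
split.
- by move=> /inball Bxy; exact: Sigma_Qmap.
- move=> Mh; have [Bxy|nB] := pselect (euclidean_ball M (x, y)).
    rewrite Sigma_Qmap//; apply: (@le_trans _ _ (l * (`|x + y| / s2))).
      apply: lP => //; rewrite ler_pdivrMr//.
      have s21 : 1 <= s2 by rewrite -sqrtr1 ler_sqrt//; lra.
      move: Bxy; rewrite /euclidean_ball /= -{1}(gtr0_norm M_gt0) -sqrtr_sqr.
      rewrite ltr_sqrt ?exprn_gt0// => Bxy.
      suff : `|x + y| <= 2 * M by nra.
      rewrite -ler_sqr ?nnegrE ?mulr_ge0 ?(ltW M0)// real_normK ?num_real//; nra.
    rewrite ler_wpM2r ?le_max ?lexx// divr_ge0// ltW//.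
  apply: (@le_trans _ _ ((1 - c / 2) * (`|x + y| / s2))).
    rewrite mulrA ler_pM2r ?invr_gt0//.
    rewrite norm_sub_same_sign// norm_add_same_sign//.
    have /andP[ax bx] := Sigma_sector Sxy nB.
    have x0 := normr_ge0 x; have y0 := normr_ge0 y.
    have h1 : c * `|x| <= `|y| by nra.
    have h2 : c * `|y| <= `|x| by nra.
    by rewrite ler_norml; apply/andP; split; nra.
  by rewrite ler_wpM2r ?le_max ?lexx ?orbT// divr_ge0// ltW.
- move=> h0; rewrite divr_gt0// normr_gt0 subr_eq0; apply/eqP => yx.
  have : (Sigma `&` [set w : R * R | w.1 = w.2]) (x, y) by split.
  rewrite Sigma_diag => -[x0 y0]; move: h0.
  by rewrite x0 y0 addr0 normr0 mul0r ltxx.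
Qed.

End BoundaryStep.

(** * Isometries of the line and primitives *)

Section AlmostEverywhere.
Context (R : realType).
Local Notation mu := (@lebesgue_measure R).
Implicit Types P : R -> Prop.

Lemma ae_imply P P' : (forall x, P x -> P' x) ->
  {ae mu, forall x, P x} -> {ae mu, forall x, P' x}.
Proof.
by move=> PP'; apply: filterS; first exact: (ae_filter_ringOfSetsType mu).
Qed.

Lemma ae_and P P' : {ae mu, forall x, P x} -> {ae mu, forall x, P' x} ->
  {ae mu, forall x, P x /\ P' x}.
Proof.
move=> aP aP'; apply: filterS2 aP aP'; last by split.
exact: (ae_filter_ringOfSetsType mu).
Qed.

Lemma ae_all (P : nat -> R -> Prop) : (forall n, {ae mu, forall x, P n x}) ->
  {ae mu, forall x, forall n, P n x}.
Proof. exact: ae_foralln. Qed.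

End AlmostEverywhere.

Section Isometries.
Context (R : realType).
Local Notation mu := (@lebesgue_measure R).

Definition preserves_lebesgue (phi : R -> R) : Prop :=
  measurable_fun setT phi /\
  forall A : set R, measurable A -> mu (phi @^-1` A) = mu A.

Lemma shift_preserves (c : R) : preserves_lebesgue (fun x => c + x).
Proof.
have mphi : measurable_fun setT (fun x : R => c + x) by exact: measurable_funD.
split => // A mA.
transitivity (pushforward mu (fun x : R => c + x : measurableTypeR R) A) => //.
apply/esym/lebesgue_measure_unique => //= _ [[a b]] _ <- /=.
rewrite /pushforward.
have -> : (fun x : R => c + x) @^-1` `]a, b] = `]a - c, b - c]%classic.
  by apply/seteqP; split => x /=; rewrite !in_itv /= ltrBlDl lerBrDl.
rewrite !lebesgue_measure_itv /= !lte_fin ltrD2r; case: ifPn => // _.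
by rewrite -!EFinD; congr EFin; lra.
Qed.

Lemma reflect_preserves (c : R) : preserves_lebesgue (fun x => c - x).
Proof.
have mphi : measurable_fun setT (fun x : R => c - x) by exact: measurable_funB.
split => // A mA.
transitivity (pushforward mu (fun x : R => c - x : measurableTypeR R) A) => //.
apply/esym/lebesgue_measure_unique => //= _ [[a b]] _ <- /=.
rewrite /pushforward.
have -> : (fun x : R => c - x) @^-1` `]a, b] = `[c - b, c - a[%classic.
  apply/seteqP; split => x /=; rewrite !in_itv /= => /andP[? ?];
  by apply/andP; split; lra.
rewrite !lebesgue_measure_itv /= !lte_fin ltrD2l ltrN2; case: ifPn => // _.
by rewrite -!EFinD; congr EFin; lra.
Qed.

Context (phi : R -> R) (phiP : preserves_lebesgue phi).

Lemma preserves_ae (P : R -> Prop) :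
  {ae mu, forall x, P x} -> {ae mu, forall x, P (phi x)}.
Proof.
move=> [N [mN N0 sub]]; have [mphi pP] := phiP.
exists (phi @^-1` N); split.
- by rewrite -[X in measurable X]setTI; exact: mphi.
- by rewrite pP.
- by move=> x /= nP; apply: sub.
Qed.

Lemma preserves_ge0_integral (f : R -> \bar R) : measurable_fun setT f ->
  (forall x, (0 <= f x)%E) -> (\int[mu]_x f (phi x) = \int[mu]_x f x)%E.
Proof.
move=> mf f0; have [mphi pP] := phiP.
transitivity (\int[pushforward mu (phi : R -> measurableTypeR R)]_x f x)%E.
  by rewrite ge0_integral_pushforward//= preimage_setT.
by apply: eq_measure_integral => //= A mA _; rewrite /pushforward pP.
Qed.

Lemma preserves_integrable (f : R -> R) : mu.-integrable setT (EFin \o f) ->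
  mu.-integrable setT (EFin \o (f \o phi)).
Proof.
move=> /integrableP[mf foo]; have [mphi pP] := phiP.
apply/integrableP; split.
  rewrite [X in measurable_fun _ X](_ : _ = (EFin \o f) \o phi)//.
  exact: measurableT_comp.
rewrite (preserves_ge0_integral (f := fun x => `|(f x)%:E|%E))//.
exact: measurableT_comp.
Qed.

Lemma preserves_Rintegral (f : R -> R) : mu.-integrable setT (EFin \o f) ->
  \int[mu]_x f (phi x) = \int[mu]_x f x.
Proof.
move=> intf; have [mphi pP] := phiP; rewrite /Rintegral; congr fine.
have mf : measurable_fun setT (EFin \o f) by case/integrableP: intf.
transitivity (\int[pushforward mu (phi : R -> measurableTypeR R)]_x (f x)%:E)%E.
  rewrite integral_pushforward//= preimage_setT.
  exact: (preserves_integrable intf).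
by apply: eq_measure_integral => //= A mA _; rewrite /pushforward pP.
Qed.

End Isometries.

Section Primitive.
Context (R : realType).
Local Notation mu := (@lebesgue_measure R).
Implicit Types h : R -> R.

Definition prim h (x : R) : R := \int[mu]_(t in `]-oo, x]) h t.

Lemma primB h (a b : R) : mu.-integrable setT (EFin \o h) -> a <= b ->
  prim h b - prim h a = \int[mu]_(t in `]a, b]) h t.
Proof.
move=> ih ab; rewrite /prim Rintegral_itvB ?bnd_simp//.
exact: integrableS ih.
Qed.

Lemma prim_continuous h : mu.-integrable setT (EFin \o h) ->
  continuous (prim h).
Proof.
move=> ih; have small e : 0 < e -> exists2 d, 0 < d &
    forall a b, a <= b -> b - a < d -> `|prim h b - prim h a| < e.
  move=> e0; have [d [d0 dP]] := integral_normr_continuous ih e0.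
  exists d => // a b ab bad; rewrite primB//.
  have mab : (mu `]a, b]%classic < d%:E)%E.
    rewrite lebesgue_measure_itv /= lte_fin.
    by case: ifPn => _; rewrite -?EFinD lte_fin.
  have iab : mu.-integrable `]a, b] (EFin \o h) by exact: integrableS ih.
  apply: (le_lt_trans (le_normr_Rintegral _ iab)) => //.
  exact: dP.
move=> x; apply/cvgrPdist_lt => e /small[d d0 dP].
apply/nbhs_ballP; exists d => //= y; rewrite /ball /= => xy.
have [xley|yltx] := leP x y.
  rewrite distrC; apply: dP => //.
  by rewrite -(ger0_norm (x := y - x)) ?subr_ge0 1?distrC.
by apply: dP; [exact: ltW|exact: le_lt_trans (ler_norm _) xy].
Qed.

(** By Lebesgue differentiation an integrable function is determined almost
    everywhere by its primitive. *)
Lemma prim_constant_ae0 h (a b c : R) : mu.-integrable setT (EFin \o h) ->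
  (forall x, a < x < b -> prim h x = c) ->
  {ae mu, forall x, a < x < b -> h x = 0}.
Proof.
move=> ih hc.
have loc : locally_integrable setT h.
  by apply: open_integrable_locally => //; exact: openT.
have ihy y : mu.-integrable `]-oo, y] (EFin \o h) by exact: integrableS ih.
have := FTC1Ny ihy loc; apply: ae_imply => x /= [_ <-] /andP[ax xb].
have near_c : \forall y \near x, prim h y = cst c y.
  near=> y; apply: hc; apply/andP; split; near: y.
    exact: lt_nbhsr.
  exact: lt_nbhsl.
rewrite derive1E (near_eq_derive _ near_c) ?derive_cst//.
Unshelve. all: by end_near. Qed.

End Primitive.

(** * Exchange of integrals *)

Section IntegrationByParts.
Context (R : realType).
Local Notation mu := (@lebesgue_measure R).

Lemma integrable_patch (h : R -> R) (D : set R) : measurable D ->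
  mu.-integrable D (EFin \o h) -> mu.-integrable setT (EFin \o (h \_ D)).
Proof. by move=> mD; rewrite integrable_mkcond//= restrict_EFin. Qed.

(** Fubini on the half-plane [y <= x]. *)
Lemma Rintegral_triangle (g w : R -> R) :
  mu.-integrable setT (EFin \o g) -> mu.-integrable setT (EFin \o w) ->
  \int[mu]_x (g x * prim w x) =
  \int[mu]_y (w y * \int[mu]_(x in `[y, +oo[) g x).
Proof.
move=> ig iw.
have mg : measurable_fun setT g by case/integrableP: ig => /measurable_EFinP.
have mw : measurable_fun setT w by case/integrableP: iw => /measurable_EFinP.
have mnw : measurable_fun setT (fun y => `|(w y)%:E|%E).
  by apply: measurableT_comp => //; exact/measurable_EFinP.
pose F (z : R * R) : R := if z.2 <= z.1 then g z.1 * w z.2 else 0.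
have mF : measurable_fun setT F.
  apply: measurable_fun_ifT => //; first exact: measurable_fun_ler.
  by apply: measurable_funM; exact: measurableT_comp.
have Fx x y : F (x, y) = g x * (w \_ `]-oo, x]) y.
  rewrite /F patchE mem_setE in_itv /=.
  by case: ifPn => // _; rewrite mulr0.
have Fy x y : F (x, y) = w y * (g \_ `[y, +oo[) x.
  rewrite /F patchE mem_setE in_itv /= andbT mulrC.
  by case: ifPn => // _; rewrite mulr0.
have iwx x : mu.-integrable setT (EFin \o (w \_ `]-oo, x])).
  by apply: integrable_patch => //; exact: integrableS iw.
have mwx x : measurable_fun setT (w \_ `]-oo, x]).
  by have /integrableP[/measurable_EFinP] := iwx x.
have mFx x : measurable_fun setT (fun y => F (x, y)).
  rewrite (_ : (fun y => _) = (fun y => g x * (w \_ `]-oo, x]) y)).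
    exact: measurable_funM.
  by apply/funext => y; exact: Fx.
have igy y : mu.-integrable setT (EFin \o (g \_ `[y, +oo[)).
  by apply: integrable_patch => //; exact: integrableS ig.
have iF : (mu \x mu)%E.-integrable setT (EFin \o F).
  apply/integrable12ltyP; first exact/measurable_EFinP.
  have wfin : (\int[mu]_y `|(w y)%:E| < +oo)%E by case/integrableP: iw.
  have [_ gfin] := integrableP _ _ _ ig.
  apply: (@le_lt_trans _ _ (\int[mu]_x (`|(g x)%:E| * \int[mu]_y `|(w y)%:E|))%E).
    apply: ge0_le_integral => //.
    - by move=> x _; exact: integral_ge0.
    - apply: (@measurable_fun_fubini_tonelli_F _ _ _ _ R
        (@lebesgue_measure R) (abse \o (EFin \o F))) => //=.
      by apply: measurableT_comp => //; exact/measurable_EFinP.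
    - apply: emeasurable_funM => //.
      by apply: measurableT_comp => //; exact/measurable_EFinP.
    - move=> x _ /=; rewrite -ge0_integralZl//.
      apply: ge0_le_integral => //.
      + apply/measurable_EFinP; apply: measurableT_comp => //.
        exact: mFx.
      + by apply: emeasurable_funM => //; exact: mnw.
      + move=> y _; rewrite -EFinM lee_fin -normrM /F /=.
        by case: ifPn => // _; rewrite normr0.
  rewrite ge0_integralZr//.
  - apply: lte_mul_pinfty => //; first exact: integral_ge0.
    by rewrite ge0_fin_numE//; exact: integral_ge0.
  - by apply: measurableT_comp => //; exact/measurable_EFinP.
  - exact: integral_ge0.
have := Fubini iF; rewrite /Rintegral => H; congr fine.
transitivity (\int[mu]_x \int[mu]_y (EFin \o F) (x, y))%E.
  apply: eq_integral => x _ /=; under eq_integral do rewrite Fx EFinM.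
  rewrite (integralZl measurableT (iwx x)).
  rewrite EFinM /prim /Rintegral; congr (_ * _)%E.
  rewrite [in RHS](_ : (fun y => _) = EFin \o (w \_ `]-oo, x]))//.
  rewrite -restrict_EFin -integral_mkcond fineK//.
  have iwx' : mu.-integrable `]-oo, x] (EFin \o w) by exact: integrableS iw.
  exact: integrable_fin_num iwx'.
rewrite H.
apply: eq_integral => y _ /=; under eq_integral do rewrite Fy EFinM.
rewrite (integralZl measurableT (igy y)).
rewrite EFinM /Rintegral; congr (_ * _)%E.
rewrite [in LHS](_ : (fun y => _) = EFin \o (g \_ `[y, +oo[))//.
rewrite -restrict_EFin -integral_mkcond fineK//.
have igy' : mu.-integrable `[y, +oo[ (EFin \o g) by exact: integrableS ig.
exact: integrable_fin_num igy'.
Qed.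

End IntegrationByParts.

(** * Primitives have weak derivatives *)

Section WeakDerivatives.
Context (R : realType).
Local Notation mu := (@lebesgue_measure R).
Implicit Types u w k phi : R -> R.

Lemma ptwise_bounded phi (K : R) : (forall x, `|phi x| <= K) ->
  [bounded phi x | x in setT].
Proof.
move=> pK; exists K; split; first exact: num_real.
by move=> L KL x _ /=; exact: le_trans (pK x) (ltW KL).
Qed.

Lemma compact_support_bounded phi (a b : R) : continuous phi ->
  (forall x, ~ (a <= x <= b) -> phi x = 0) -> exists K, forall x, `|phi x| <= K.
Proof.
move=> cphi phi0.
have cn : {within `[a, b], continuous (fun x => `|phi x|)}.
  apply: continuous_subspaceT => x.
  by apply: continuous_comp; [exact: cphi|exact: norm_continuous].
have [ab|ba] := leP a b; last first.
  by exists 0 => x; rewrite phi0 ?normr0// => /andP[? ?]; lra.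
have [c _ cP] := EVT_max ab cn; exists `|phi c| => x.
have [xab|xab] := pselect (a <= x <= b).
  by apply: cP; rewrite in_itv.
by rewrite phi0// normr0.
Qed.

Lemma test_function_continuous phi : test_function phi -> continuous phi.
Proof.
by move=> [d _ _] x; apply: differentiable_continuous; apply/derivable1_diffP.
Qed.

Lemma derive1_compact_support phi (a b : R) :
  (forall x, ~ (a <= x <= b) -> phi x = 0) ->
  forall x, ~ (a <= x <= b) -> derive1 phi x = 0.
Proof.
move=> phi0 x xab; rewrite derive1E.
have near0 : \forall y \near x, phi y = cst 0 y.
  have [xa|ax] := ltP x a.
    near=> y; apply: phi0 => /andP[ay _].
    have : y < a by near: y; exact: lt_nbhsl.
    by lra.
  have bx : b < x by rewrite ltNge; apply/negP => xb; apply: xab; rewrite ax.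
  near=> y; apply: phi0 => /andP[_ yb].
  have : b < y by near: y; exact: lt_nbhsr.
  by lra.
by rewrite (near_eq_derive _ near0) derive_cst.
Unshelve. all: by end_near. Qed.

Lemma compact_support_integrable phi (a b : R) : continuous phi ->
  (forall x, ~ (a <= x <= b) -> phi x = 0) ->
  mu.-integrable setT (EFin \o phi).
Proof.
move=> cphi phi0.
rewrite (_ : phi = phi \_ `[a, b]); last first.
  apply/funext => x; rewrite patchE mem_setE in_itv /=.
  by case: ifPn => // /negP /phi0.
apply: integrable_patch => //.
apply: continuous_compact_integrable; first exact: segment_compact.
exact: continuous_subspaceT.
Qed.

Lemma locally_integrable_mul_test k phi (a b : R) : 0 < a -> b < 1 ->
  locally_integrable `]0, 1[ k -> continuous phi ->
  (forall x, ~ (a <= x <= b) -> phi x = 0) ->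
  mu.-integrable setT (EFin \o (fun x => k x * phi x)).
Proof.
move=> a0 b1 [mk _ kfin] cphi phi0.
have sub : `[a, b] `<=` (`]0, 1[ : set R).
  by move=> x /=; rewrite !in_itv /= => /andP[? ?]; apply/andP; split; lra.
have ik : mu.-integrable `[a, b] (EFin \o k).
  apply/integrableP; split.
    by apply/measurable_EFinP; exact: measurable_funS mk.
  by apply: kfin => //; exact: segment_compact.
rewrite (_ : (fun x => _) = (fun x => (k \_ `[a, b]) x * phi x)); last first.
  apply/funext => x; rewrite patchE mem_setE in_itv /=.
  by case: ifPn => // /negP /phi0 ->; rewrite !mulr0.
have [K phiK] := compact_support_bounded cphi phi0.
rewrite (_ : _ \o _ = (EFin \o (k \_ `[a, b])) \* (EFin \o phi))%E//.
apply: integrableMl => //; first exact: integrable_patch.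
- exact: continuous_measurable_fun.
- exact: ptwise_bounded phiK.
Qed.

Lemma Rintegral_support phi : (forall x, ~ (0 < x < 1) -> phi x = 0) ->
  \int[mu]_(x in `]0, 1[) phi x = \int[mu]_x phi x.
Proof.
move=> phi0; rewrite Rintegral_mkcond; congr Rintegral.
apply/funext => x; rewrite patchE mem_setE in_itv /=.
by case: ifPn => // /negP /phi0.
Qed.

Lemma test_function_tail phi (y : R) : test_function phi ->
  \int[mu]_(x in `[y, +oo[) derive1 phi x = - phi y.
Proof.
move=> tphi; have [d cd [a [b [a0 b1 phi0]]]] := tphi.
have d0 := derive1_compact_support phi0.
have [y1|y1] := ltP y 1; last first.
  rewrite (@eq_Rintegral _ _ _ _ _ (cst 0)); last first.
    move=> x; rewrite inE /= in_itv /= andbT => yx.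
    by rewrite d0// => /andP[? ?]; lra.
  by rewrite Rintegral_cst// mul0r phi0 ?oppr0// => /andP[? ?]; lra.
rewrite Rintegral_mkcond.
rewrite (_ : (derive1 phi) \_ _ = (derive1 phi) \_ `[y, 1]); last first.
  apply/funext => x; rewrite !patchE !mem_setE !in_itv /= andbT.
  have [yx|//] := leP y x; have [//|x1] := leP x 1.
  by rewrite d0// => /andP[? ?]; lra.
have cphi := test_function_continuous tphi.
have LR : derivable_oo_LRcontinuous phi y 1.
  split => [x _||]; first exact: d.
    by apply: cvg_at_right_filter; exact: cphi.
  by apply: cvg_at_left_filter; exact: cphi.
have cd1 : {within `[y, 1], continuous (derive1 phi)}.
  exact: continuous_subspaceT.
have FTC := continuous_FTC2 y1 cd1 LR (fun x _ => erefl).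
rewrite -Rintegral_mkcond /Rintegral FTC -EFinB /= [phi 1]phi0 ?sub0r//.
by move=> /andP[? ?]; lra.
Qed.

(** Integration by parts against a test function, for a primitive that is only
    absolutely continuous: it is the exchange of two integrals. *)
Lemma prim_is_weak_derivative u w (c : R) : mu.-integrable setT (EFin \o w) ->
  (forall x, 0 < x < 1 -> u x = c + prim w x) -> is_weak_derivative u w.
Proof.
move=> iw uE; have cp := prim_continuous iw.
have oI : open (`]0, 1[%classic : set R) by exact: interval_open.
have ccp : continuous (fun x => c + prim w x).
  by move=> x; apply: cvgD; [exact: cvg_cst|exact: cp].
split.
- apply: open_integrable_locally => //.
  have : mu.-integrable `]0, 1[ (EFin \o (fun x => c + prim w x)).
    have i01 : mu.-integrable `[0, 1] (EFin \o (fun x => c + prim w x)).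
      apply: continuous_compact_integrable; first exact: segment_compact.
      exact: continuous_subspaceT.
    by apply: integrableS i01 => //; exact: subset_itv_oo_cc.
  apply: eq_integrable => // x; rewrite inE /= in_itv /= => x01.
  by rewrite uE.
- by apply: open_integrable_locally => //; exact: integrableS iw.
- move=> phi tphi; have [d cd [a [b [a0 b1 phi0]]]] := tphi.
  have d0 := derive1_compact_support phi0.
  have cphi := test_function_continuous tphi.
  have id : mu.-integrable setT (EFin \o derive1 phi).
    exact: compact_support_integrable d0.
  have out x : ~ (0 < x < 1) -> ~ (a <= x <= b).
    by move=> H /andP[? ?]; apply: H; apply/andP; split; lra.
  transitivity (\int[mu]_x (c * derive1 phi x + derive1 phi x * prim w x)).
    rewrite -Rintegral_support; last first.
      by move=> x /out /d0 ->; rewrite mulr0 mul0r addr0.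
    apply: eq_Rintegral => x; rewrite inE /= in_itv /= => x01.
    by rewrite uE// mulrDl; congr (_ + _); rewrite mulrC.
  rewrite RintegralD//; last 2 first.
  + by rewrite (_ : _ \o _ = (fun x => c%:E * (EFin \o derive1 phi) x)%E)//;
      exact: integrableZl.
  + apply: (@compact_support_integrable _ a b).
      by move=> x; apply: cvgM; [exact: cd|exact: cp].
    by move=> x /d0 ->; rewrite mul0r.
  rewrite RintegralZl// Rintegral_triangle//.
  have -> : \int[mu]_x derive1 phi x = 0.
    have := test_function_tail 0 tphi.
    rewrite [phi 0]phi0 ?oppr0; last by move=> /andP[? ?]; lra.
    move=> <-; rewrite [RHS]Rintegral_mkcond; congr Rintegral.
    apply/funext => x; rewrite patchE mem_setE in_itv /= andbT.
    by case: leP => // x0; rewrite d0// => /andP[? ?]; lra.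
  rewrite mulr0 add0r Rintegral_support; last first.
    by move=> x /out /phi0 ->; rewrite mulr0.
  transitivity (\int[mu]_x (-1 * (w x * phi x))).
    apply: eq_Rintegral => x _; rewrite test_function_tail//; lra.
  rewrite RintegralZl ?mulN1r//.
  have [K phiK] := compact_support_bounded cphi phi0.
  rewrite (_ : _ \o _ = (EFin \o w) \* (EFin \o phi))%E//.
  apply: integrableMl => //.
  + exact: continuous_measurable_fun.
  + exact: ptwise_bounded phiK.
Qed.

End WeakDerivatives.

(** * Uniqueness of weak derivatives *)

Section WeakDerivativeUnique.
Context (R : realType).
Local Notation mu := (@lebesgue_measure R).
Implicit Types u w k phi : R -> R.

Lemma is_derive_pos_sqr (s : R) :
  is_derive s (1 : R) (fun x : R => Num.max x 0 ^+ 2) (2 * Num.max s 0).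
Proof.
pose F := fun x : R => Num.max x 0 ^+ 2.
have quad (h : R) : `|F (h + s) - F s - 2 * Num.max s 0 * h| <= h ^+ 2.
  rewrite /F; case: (leP s 0) => s0; case: (leP (h + s) 0) => hs0;
    rewrite ?(max_r s0) ?(max_r hs0) ?(max_l (ltW s0)) ?(max_l (ltW hs0));
    rewrite ler_norml; apply/andP; split; nra.
have lim : h^-1 *: (F (h *: (1 : R) + s) - F s) @[h --> 0^'] --> 2 * Num.max s 0.
  apply/cvgrPdist_lt => e e0; near=> h.
  have h0 : h != 0 by near: h; exact: nbhs_dnbhs_neq.
  have he : `|h| < e by near: h; exact: dnbhs0_lt.
  apply: le_lt_trans he; rewrite distrC.
  have h1 : 0 < `|h| by rewrite normr_gt0.
  rewrite -(ler_pM2r h1) -normrM -expr2 real_normK ?num_real//.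
  apply: le_trans (quad h).
  rewrite [h *: (1 : R)]mulr1 mulrBl; rewrite le_eqVlt; apply/orP; left.
  by rewrite mulrAC mulVf ?mul1r.
split; first by apply/cvg_ex; exists (2 * Num.max s 0).
by apply/cvg_lim => //; exact: Rhausdorff.
Unshelve. all: by end_near. Qed.

(** A [C^1] bump, positive exactly on [(a, b)]. *)
Definition bump (a b x : R) : R := Num.max ((x - a) * (b - x)) 0 ^+ 2.

Lemma bump_out (a b x : R) : a < b -> ~ (a < x < b) -> bump a b x = 0.
Proof.
move=> ab xab; rewrite /bump max_r ?expr0n//.
have [xa|ax] := leP x a; first by nra.
have [bx|xb] := leP b x; first by nra.
by case: xab; rewrite ax.
Qed.

Lemma bump_in (a b x : R) : 0 < a -> b < 1 -> a < x < b -> 0 < bump a b x <= 1.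
Proof.
move=> a0 b1 /andP[ax xb]; have p0 : 0 < (x - a) * (b - x).
  by rewrite mulr_gt0// subr_gt0.
have p1 : (x - a) * (b - x) <= 1 by nra.
by rewrite /bump (max_l (ltW p0)) exprn_gt0// exprn_ile1// ltW.
Qed.

(** When [(a, b)] is in the unit interval, these functions increase with [n] to
    its indicator function. *)
Definition plateau (a b : R) (n : nat) (x : R) : R := 1 - (1 - bump a b x) ^+ n.

Lemma plateau_test (a b : R) n : 0 < a -> a < b -> b < 1 ->
  test_function (plateau a b n).
Proof.
move=> a0 ab b1.
have der (x : R) : is_derive x 1 (plateau a b n)
   (n%:R * (1 - bump a b x) ^+ n.-1 *
     (2 * Num.max ((x - a) * (b - x)) 0 * (a + b - 2 * x))).
  have dP : is_derive x (1 : R) (fun x : R => (x - a) * (b - x)) (a + b - 2 * x).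
    apply: is_derive_eq; rewrite /GRing.scale /=; ring.
  have dB : is_derive x (1 : R) (bump a b)
      (2 * Num.max ((x - a) * (b - x)) 0 * (a + b - 2 * x)).
    exact: is_derive1_comp (is_derive_pos_sqr _) dP.
  have d1 : is_derive x (1 : R) (fun y => 1 - bump a b y)
     (- (2 * Num.max ((x - a) * (b - x)) 0 * (a + b - 2 * x))).
    by apply: is_derive_eq; rewrite add0r mul1r.
  have dn : is_derive x (1 : R) (fun y => (1 - bump a b y) ^+ n)
     (n%:R * (1 - bump a b x) ^+ n.-1 *
     - (2 * Num.max ((x - a) * (b - x)) 0 * (a + b - 2 * x))).
    by have := is_deriveX n d1; rewrite exprfctE.
  by apply: is_derive_eq; rewrite add0r mul1r mulrN opprK.
split.
- by move=> x; have [] := der x.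
- have -> : derive1 (plateau a b n) = fun x =>
     n%:R * (1 - bump a b x) ^+ n.-1 *
     (2 * Num.max ((x - a) * (b - x)) 0 * (a + b - 2 * x)).
    by apply/funext => x; rewrite derive1E; have [] := der x.
  have cpoly : continuous (fun x : R => (x - a) * (b - x)).
    move=> x; apply: cvgM; first by apply: cvgB; [exact: cvg_id|exact: cvg_cst].
    by apply: cvgB; [exact: cvg_cst|exact: cvg_id].
  have cmax : continuous (fun x : R => Num.max ((x - a) * (b - x)) 0).
    move=> x.
    have := @continuous_max _ _ (fun x => (x - a) * (b - x)) (fun=> 0) x.
    by apply; [exact: cpoly|exact: cvg_cst].
  have cbump : continuous (bump a b).
    move=> x; exact: (@continuous_comp _ _ _
      (fun x => Num.max ((x - a) * (b - x)) 0) (fun y : R => y ^+ 2)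
      x (cmax x) (@exprn_continuous R 2 _)).
  move=> x; apply: cvgM.
    apply: cvgM; first exact: cvg_cst.
    apply: (@continuous_comp _ _ _ (fun x => 1 - bump a b x)
      (fun y : R => y ^+ n.-1) x); last exact: (@exprn_continuous R n.-1).
    by apply: cvgB; [exact: cvg_cst|exact: cbump].
  apply: cvgM; first by apply: cvgM; [exact: cvg_cst|exact: cmax].
  by apply: cvgB; [exact: cvg_cst|apply: cvgM; [exact: cvg_cst|exact: cvg_id]].
- exists a, b; split => // x xab.
  rewrite /plateau bump_out// ?subr0 ?expr1n ?subrr//.
  by move=> /andP[ax xb]; apply: xab; rewrite !ltW.
Qed.

(** Dominated convergence along [plateau a b n]. *)
Lemma test_ortho_integral0 k (a b : R) : locally_integrable `]0, 1[ k ->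
  (forall phi, test_function phi -> \int[mu]_(x in `]0, 1[) (k x * phi x) = 0) ->
  0 < a -> a < b -> b < 1 -> \int[mu]_(x in `]a, b[) k x = 0.
Proof.
move=> lk ort a0 ab b1; have [mk _ kfin] := lk.
have sub : `[a, b] `<=` (`]0, 1[ : set R).
  by move=> x /=; rewrite !in_itv /= => /andP[? ?]; apply/andP; split; lra.
have ik : mu.-integrable `[a, b] (EFin \o k).
  apply/integrableP; split.
    by apply/measurable_EFinP; exact: measurable_funS mk.
  by apply: kfin => //; exact: segment_compact.
have iko : mu.-integrable `]a, b[ (EFin \o k).
  by apply: integrableS ik => //; exact: subset_itv_oo_cc.
have mko : measurable_fun `]a, b[ k.
  by have /integrableP[/measurable_EFinP] := iko.
pose f_ n := EFin \o (fun x => k x * plateau a b n x).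
have outI phi : (forall x, ~ (a < x < b) -> phi x = 0) ->
    (\int[mu]_(x in `]0%R, 1%R[) (phi x)%:E =
     \int[mu]_(x in `]a, b[) (phi x)%:E)%E.
  move=> phi0; rewrite [LHS]integral_mkcond [RHS]integral_mkcond.
  congr integral; apply/funext => x; rewrite !patchE !mem_setE !in_itv /=.
  case: ifPn => x01; case: ifPn => // xab.
    by rewrite phi0//; exact/negP.
  by move: xab x01 => /andP[ax xb] /negP[]; apply/andP; split; lra.
have zero n : (\int[mu]_(x in `]a, b[) f_ n x = 0)%E.
  have tn := plateau_test n a0 ab b1.
  rewrite -outI; last first.
    by move=> x xab; rewrite /plateau bump_out// subr0 expr1n subrr mulr0.
  have := ort _ tn; rewrite /Rintegral => H.
  rewrite -[LHS]fineK ?H//; apply: integrable_fin_num => //.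
  have [_ _ [a' [b' [a'0 b'1 out]]]] := tn.
  have := locally_integrable_mul_test a'0 b'1 lk
    (test_function_continuous tn) out.
  by apply: integrableS.
have mf n : measurable_fun `]a, b[ (f_ n).
  apply/measurable_EFinP; apply: measurable_funM => //.
  apply: measurable_funTS; apply: continuous_measurable_fun.
  exact/test_function_continuous/plateau_test.
have mkE : measurable_fun `]a, b[ (EFin \o k) by exact/measurable_EFinP.
have cv : {ae mu, forall x, `]a, b[%classic x ->
    f_ n x @[n --> \oo] --> (k x)%:E}.
  apply: aeW => x /=; rewrite in_itv /= => xab.
  have /andP[p0 p1] := bump_in a0 b1 xab.
  apply/cvg_EFin; first exact: nearW.
  rewrite -[X in _ --> X]mulr1; apply: cvgM; first exact: cvg_cst.
  rewrite -[X in _ --> X]subr0; apply: cvgB; first exact: cvg_cst.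
  by apply: cvg_expr; rewrite ger0_norm; lra.
have dom : {ae mu, forall x, forall n, `]a, b[%classic x ->
    (`|f_ n x| <= `|(k x)%:E|)%E}.
  apply: aeW => x /= n; rewrite in_itv /= => xab.
  have /andP[p0 p1] := bump_in a0 b1 xab.
  rewrite lee_fin normrM -[leRHS]mulr1 ler_wpM2l//.
  have : 0 <= (1 - bump a b x) ^+ n <= 1.
    by rewrite exprn_ge0 ?exprn_ile1//; lra.
  by rewrite /plateau => /andP[? ?]; rewrite ger0_norm; lra.
have [_ _] := @dominated_convergence _ _ _ (@lebesgue_measure R) _
  (measurable_itv _) f_ (EFin \o k) _ mf mkE cv (integrable_abse iko) dom.
rewrite (_ : (fun n => _) = cst 0%E); last by apply/funext => n; exact: zero.
by rewrite /Rintegral => /(cvg_unique _ (cvg_cst _)) /= <-.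
Qed.

(** The fundamental lemma of the calculus of variations: the primitive of [k] is
    constant on every compact subinterval, hence [k] vanishes there. *)
Lemma test_ortho_ae0 k : locally_integrable `]0, 1[ k ->
  (forall phi, test_function phi -> \int[mu]_(x in `]0, 1[) (k x * phi x) = 0) ->
  {ae mu, forall x, 0 < x < 1 -> k x = 0}.
Proof.
move=> lk ort.
have step (n : nat) :
    {ae mu, forall x, n.+2%:R^-1 < x < 1 - n.+2%:R^-1 -> k x = 0}.
  set c : R := n.+2%:R^-1; pose d := 1 - c.
  have c0 : 0 < c by rewrite invr_gt0.
  have [mk _ kfin] := lk.
  have d1 : d < 1 by rewrite /d; lra.
  have sub : `[c, d] `<=` (`]0, 1[ : set R).
    by move=> x /=; rewrite !in_itv /= => /andP[? ?]; apply/andP; split; lra.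
  have ik : mu.-integrable `[c, d] (EFin \o k).
    apply/integrableP; split.
      by apply/measurable_EFinP; exact: measurable_funS mk.
    by apply: kfin => //; exact: segment_compact.
  have ik1 : mu.-integrable `]c, d[ (EFin \o k).
    by apply: integrableS ik => //; exact: subset_itv_oo_cc.
  have := @prim_constant_ae0 _ (k \_ `]c, d[) c d 0 (integrable_patch _ ik1).
  move=> /(_ (measurable_itv _)) H.
  suff : {ae mu, forall x, c < x < d -> (k \_ `]c, d[) x = 0}.
    apply: ae_imply.
    by move=> x /= kx xcd; rewrite -(kx xcd) patchE mem_setE in_itv /= xcd.
  apply: H => x /andP[cx xd].
  rewrite /prim Rintegral_mkcond -patch_setI -Rintegral_mkcond.
  rewrite (_ : _ `&` _ = `]c, x]%classic); last first.
    apply/seteqP; split => y /=; rewrite !in_itv /=.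
      by move=> [-> /andP[->]].
    by move=> /andP[-> yx]; split => //; apply: le_lt_trans yx xd.
  rewrite -Rintegral_itv_bndo_bndc.
    by apply: (test_ortho_integral0 lk ort) => //; lra.
  apply: integrableS ik1 => // y /=; rewrite !in_itv /= => /andP[? ?].
  by apply/andP; split; lra.
have := ae_all step; apply: ae_imply => x kx /andP[x0 x1].
have m0 : 0 < Num.min x (1 - x) by rewrite lt_min x0 subr_gt0.
have [n _ /(_ n (leqnn n))] := near_infty_natSinv_lt (PosNum m0).
rewrite /= lt_min => /andP[nx nx1].
apply: (kx n); have : n.+2%:R^-1 < n.+1%:R^-1 :> R.
  by rewrite ltf_pV2 ?posrE// ltr_nat.
by move: nx nx1; move: (n.+1%:R^-1) (n.+2%:R^-1) => c d *; apply/andP; split; lra.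
Qed.

Lemma weak_derivative_unique u w w' :
  is_weak_derivative u w -> is_weak_derivative u w' ->
  {ae mu, forall x, 0 < x < 1 -> w x = w' x}.
Proof.
move=> [_ lw wP] [_ lw' wP'].
have := @test_ortho_ae0 (w \- w') (locally_integrableB lw lw').
suff H : forall phi, test_function phi ->
    \int[mu]_(x in `]0, 1[) ((w \- w') x * phi x) = 0.
  move=> /(_ H); apply: ae_imply.
  by move=> x /= wx /wx /eqP; rewrite subr_eq0 => /eqP.
move=> phi tphi; have [_ _ [a [b [a0 b1 out]]]] := tphi.
have cphi := test_function_continuous tphi.
under eq_Rintegral do rewrite mulrBl.
have i1 := locally_integrable_mul_test a0 b1 lw cphi out.
have i2 := locally_integrable_mul_test a0 b1 lw' cphi out.
rewrite RintegralB//; [|exact: integrableS i1|exact: integrableS i2].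
by apply/eqP; rewrite subr_eq0 -eqr_opp -(wP _ tphi) -(wP' _ tphi).
Qed.

End WeakDerivativeUnique.

(** * Lebesgue norms on subsets of the line *)

Section LpNorm.
Context (R : realType).
Local Notation mu := (@lebesgue_measure R).
Implicit Types (f g : R -> R) (D : set R) (r : R).

Lemma Lp_normE D f r : 1 <= r -> measurable D ->
  Lp_norm D r%:E f = ((\int[mu]_(x in D) (`|f x| `^ r)%:E) `^ r^-1)%E.
Proof.
move=> r1 mD; have r0 : r != 0 by rewrite gt_eqF//; lra.
have E : (\int[mu]_x `|(EFin \o (f \_ D)) x| `^ r =
    \int[mu]_(x in D) (`|f x| `^ r)%:E)%E.
  rewrite [RHS]integral_mkcond; apply: eq_integral => x _.
  by rewrite /= !patchE; case: ifPn => //= _; rewrite normr0 powR0.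
by rewrite /Lp_norm unlock /= -E.
Qed.

Lemma lebesgue_setT_gt0 : (0 < mu setT)%E.
Proof.
apply: (@lt_le_trans _ _ (mu `[0%R, 1%R])).
  by rewrite lebesgue_measure_itv /= lte01 oppr0 adde0 lte01.
by apply: le_measure; rewrite ?inE.
Qed.

(** For a nonnegative bound the values 0 outside [D] do not matter. *)
Lemma Lp_norm_oo_le D f (y : \bar R) : (0 <= y)%E ->
  (Lp_norm D +oo f <= y)%E <->
  {ae mu, forall x, D x -> (`|f x|%:E <= y)%E}.
Proof.
move=> y0; rewrite /Lp_norm unlock lebesgue_setT_gt0.
split.
  move=> /ess_supP; apply: ae_imply => x /= + Dx.
  by rewrite patchE mem_set.
move=> H; apply/ess_supP; move: H; apply: ae_imply => x /= H.
by rewrite patchE; case: ifPn => [/set_mem //|_]; rewrite normr0.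
Qed.

Lemma Lp_norm_ge0 D p f : (0 <= Lp_norm D p f)%E.
Proof. exact: Lnorm_ge0. Qed.

Lemma measurable_norm_powR D f r : measurable D -> measurable_fun D f ->
  measurable_fun D (fun x => (`|f x| `^ r)%:E).
Proof.
move=> mD mf; apply/measurable_EFinP.
apply: (measurableT_comp (measurable_powR r)).
exact: measurableT_comp.
Qed.

Lemma le_Lp_norm D p f g : (1 <= p)%E -> measurable D ->
  measurable_fun D f -> measurable_fun D g ->
  {ae mu, forall x, D x -> `|f x| <= `|g x|} ->
  (Lp_norm D p f <= Lp_norm D p g)%E.
Proof.
move=> p1 mD mf mg fg; case: p p1 => [r| |]//= r1.
  rewrite lee_fin in r1; rewrite !(Lp_normE _ r1 mD).
  have r0 : 0 <= r^-1 by rewrite invr_ge0; lra.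
  have int0 (h : R -> R) : (0 <= \int[mu]_(x in D) (`|h x| `^ r)%:E)%E.
    by apply: integral_ge0 => x _; rewrite lee_fin powR_ge0.
  apply: (gt0_ler_poweR r0); [by rewrite in_itv /= leey int0..|].
  apply: ae_ge0_le_integral => //.
  - exact: measurable_norm_powR.
  - exact: measurable_norm_powR.
  - move: fg; apply: ae_imply => x fg Dx; rewrite lee_fin.
    apply: ge0_ler_powR; rewrite ?nnegrE//; [lra|exact: fg].
apply: (Lp_norm_oo_le D f (Lp_norm_ge0 D +oo g)).2.
have := (Lp_norm_oo_le D g (Lp_norm_ge0 D +oo g)).1 (lexx _).
move=> /(ae_and fg); apply: ae_imply => x [fgx gx] Dx.
by apply: le_trans (gx Dx); rewrite lee_fin fgx.
Qed.

Lemma Lp_normZ D p f (c : R) : (1 <= p)%E -> measurable D ->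
  measurable_fun D f -> 0 < c ->
  Lp_norm D p (fun x => c * f x) = (c%:E * Lp_norm D p f)%E.
Proof.
move=> p1 mD mf c0; case: p p1 => [r| |]//= r1.
  rewrite lee_fin in r1; rewrite !(Lp_normE _ r1 mD).
  have rN0 : r != 0 by rewrite gt_eqF//; lra.
  have int0 (h : R -> R) : (0 <= \int[mu]_(x in D) (`|h x| `^ r)%:E)%E.
    by apply: integral_ge0 => x _; rewrite lee_fin powR_ge0.
  under eq_integral do rewrite normrM powRM// EFinM.
  rewrite ge0_integralZl//; last exact: measurable_norm_powR.
  rewrite poweRM ?lee_fin ?powR_ge0//; congr (_ * _)%E.
  by rewrite poweR_EFin -powRrM mulfV// powRr1// gtr0_norm.
rewrite /Lp_norm unlock lebesgue_setT_gt0 -ess_sup_pZl//; congr ess_sup.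
apply/funext => x /=; rewrite !patchE; case: ifPn => _.
  by rewrite normrM gtr0_norm// EFinM.
by rewrite normr0 mule0.
Qed.

Lemma Lp_norm_triangle D p f g : (1 <= p)%E -> measurable D ->
  measurable_fun D f -> measurable_fun D g ->
  (Lp_norm D p (f \+ g)%R <= Lp_norm D p f + Lp_norm D p g)%E.
Proof.
move=> p1 mD mf mg; rewrite /Lp_norm.
rewrite (_ : (f \+ g) \_ D = (f \_ D) \+ (g \_ D)); last first.
  by apply/funext => x /=; rewrite !patchE; case: ifPn; rewrite ?addr0.
by apply: eminkowski => //; exact/(measurable_restrictT _ _).1.
Qed.

Lemma lebesgue_oo_lty (a b : R) : (mu `]a, b[%classic < +oo)%E.
Proof.
by rewrite lebesgue_measure_itv /=; case: ifPn => // _; rewrite -EFinD ltry.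
Qed.

(** Bounded intervals have finite measure, so [L^p] embeds into [L^1]. *)
Lemma Lp_integrable (a b : R) p f : (1 <= p)%E -> Lp `]a, b[ p f ->
  mu.-integrable `]a, b[ (EFin \o f).
Proof.
move=> p1 [mf]; case: p p1 => [r| |]//= r1.
  rewrite lee_fin in r1; rewrite Lp_normE// => fin.
  have ipow : mu.-integrable `]a, b[ (fun x => (`|f x| `^ r)%:E).
    apply/integrableP; split; first exact: measurable_norm_powR.
    under eq_integral do rewrite gee0_abs ?lee_fin ?powR_ge0//.
    by apply: lty_poweRy fin; rewrite invr_neq0// gt_eqF//; lra.
  have i1 : mu.-integrable `]a, b[ (EFin \o cst 1).
    apply: measurable_bounded_integrable => //; last exact: bounded_cst.
    exact: lebesgue_oo_lty.
  apply: le_integrable (integrableD _ i1 ipow) => //.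
    exact/measurable_EFinP.
  move=> x _ /=; rewrite lee_fin [leRHS]ger0_norm ?addr_ge0 ?powR_ge0//.
  have [x1|x1] := leP `|f x| 1; first by rewrite ler_wpDr// powR_ge0.
  by rewrite ler_wpDl// le1r_powR// ltW.
move=> fin.
pose K := Lp_norm `]a, b[ +oo f.
have K0 : (0 <= K)%E by exact: Lp_norm_ge0.
have := (Lp_norm_oo_le `]a, b[ f K0).1 (lexx _).
have Kfin : K \is a fin_num by rewrite ge0_fin_numE.
move=> fK; apply/integrableP; split; first exact/measurable_EFinP.
apply: (@le_lt_trans _ _ (\int[mu]_(x in `]a, b[) cst K x)%E).
  apply: ae_ge0_le_integral => //.
  by apply: measurableT_comp => //; exact/measurable_EFinP.
rewrite integral_cst//; apply: lte_mul_pinfty => //.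
exact: lebesgue_oo_lty.
Qed.

End LpNorm.

(** * Oriented integrals and their integrands *)

Section OrientedIntegral.
Context (R : realType).
Local Notation mu := (@lebesgue_measure R).
Implicit Types (f g h : R -> R) (a s T : R).

(** Integrability up to the left endpoint [a], where the function itself may take
    any value. *)
Definition L1_loc a f : Prop :=
  forall T, mu.-integrable `]a, T[ (EFin \o f).

Lemma Lp_loc_L1_loc a p f : (1 <= p)%E -> Lp_loc a p f -> L1_loc a f.
Proof.
move=> p1 [_ H] T; have [aT|Ta] := ltP a T.
  exact: Lp_integrable p1 (H T aT).
rewrite set_itv_ge; last by rewrite bnd_simp -leNgt.
exact: integrable_set0.
Qed.

Lemma L1_locS a b f : a <= b -> L1_loc a f -> L1_loc b f.
Proof.
move=> ab H T; apply: integrableS (H T) => //.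
by move=> x /=; rewrite !in_itv /= => /andP[bx ->]; rewrite (le_lt_trans ab).
Qed.

Lemma L1_locD a f g : L1_loc a f -> L1_loc a g -> L1_loc a (f \+ g).
Proof. by move=> Hf Hg T; have := integrableD _ (Hf T) (Hg T); apply. Qed.

Lemma L1_locB a f g : L1_loc a f -> L1_loc a g -> L1_loc a (f \- g).
Proof. by move=> Hf Hg T; have := integrableB _ (Hf T) (Hg T); apply. Qed.

Lemma L1_loc_patch a f T : L1_loc a f ->
  mu.-integrable setT (EFin \o (f \_ `]a, T[)).
Proof. by move=> H; apply: integrable_patch. Qed.

(** Truncation at [T] makes the global primitive, and thus Lebesgue
    differentiation, available for functions that are only locally integrable. *)
Lemma oriented_integral_prim a T s f : L1_loc a f -> a <= 0 -> 0 < T ->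
  a <= s < T ->
  oriented_integral f 0 s = prim (f \_ `]a, T[) s - prim (f \_ `]a, T[) 0.
Proof.
move=> Hf a0 T0 /andP[ps sT].
have sub u v : a <= u -> v < T -> `]u, v] `<=` `]a, T[.
  move=> au vT x /=; rewrite !in_itv /= => /andP[ux xv].
  by rewrite (le_lt_trans au ux) (le_lt_trans xv vT).
have key u v : a <= u -> u <= v -> v < T ->
    \int[mu]_(x in `[u, v]) f x =
    prim (f \_ `]a, T[) v - prim (f \_ `]a, T[) u.
  move=> au uv vT; rewrite primB ?L1_loc_patch//.
  rewrite -Rintegral_itv_obnd_cbnd; last first.
    by apply: integrableS (Hf T) => //; exact: sub.
  apply: eq_Rintegral => x xuv; rewrite patchE mem_set//.
  by apply: (sub u v) => //; exact: set_mem.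
rewrite /oriented_integral; case: leP => s0; first exact: key.
by rewrite key ?opprB// ltW.
Qed.

Lemma primD f g s : mu.-integrable setT (EFin \o f) ->
  mu.-integrable setT (EFin \o g) -> prim (f \+ g) s = prim f s + prim g s.
Proof.
move=> fi gi; rewrite /prim RintegralD//; first exact: integrableS fi.
exact: integrableS gi.
Qed.

Lemma primB_fun f g s : mu.-integrable setT (EFin \o f) ->
  mu.-integrable setT (EFin \o g) -> prim (f \- g) s = prim f s - prim g s.
Proof.
move=> fi gi; rewrite /prim RintegralB//; first exact: integrableS fi.
exact: integrableS gi.
Qed.

Lemma oriented_integralD a s f g : L1_loc a f -> L1_loc a g -> a <= 0 ->
  a <= s -> oriented_integral (f \+ g) 0 s =
  oriented_integral f 0 s + oriented_integral g 0 s.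
Proof.
move=> Hf Hg a0 ps; pose T := Num.max s 0 + 1.
have T0 : 0 < T by rewrite ltr_pwDr// le_max lexx orbT.
have sT : a <= s < T by rewrite ps ltr_pwDr// le_max lexx.
rewrite !(oriented_integral_prim _ a0 T0 sT)//; last exact: L1_locD.
rewrite (_ : (f \+ g) \_ _ = (f \_ `]a, T[) \+ (g \_ `]a, T[)); last first.
  by apply/funext => x /=; rewrite !patchE; case: ifPn; rewrite ?addr0.
rewrite !primD ?L1_loc_patch//; ring.
Qed.

Lemma oriented_integralB a s f g : L1_loc a f -> L1_loc a g -> a <= 0 ->
  a <= s -> oriented_integral (f \- g) 0 s =
  oriented_integral f 0 s - oriented_integral g 0 s.
Proof.
move=> Hf Hg a0 ps; pose T := Num.max s 0 + 1.
have T0 : 0 < T by rewrite ltr_pwDr// le_max lexx orbT.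
have sT : a <= s < T by rewrite ps ltr_pwDr// le_max lexx.
rewrite !(oriented_integral_prim _ a0 T0 sT)//; last exact: L1_locB.
rewrite (_ : (f \- g) \_ _ = (f \_ `]a, T[) \- (g \_ `]a, T[)); last first.
  by apply/funext => x /=; rewrite !patchE; case: ifPn; rewrite ?subr0.
rewrite !primB_fun ?L1_loc_patch//; ring.
Qed.

(** A nonempty open interval has positive measure. *)
Lemma ae_eq_continuous h (a b c : R) : continuous h ->
  {ae mu, forall x, a < x < b -> h x = c} -> forall x, a < x < b -> h x = c.
Proof.
move=> ch [N [mN N0 sub]] x /andP[ax xb].
apply: contrapT => /eqP hx.
have /cvgrPdist_lt/(_ `|h x - c|) := ch x.
rewrite normr_gt0 subr_eq0 => /(_ hx) /nbhs_ballP[d /= d0 dP].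
pose l := Num.max a (x - d).
have lx : l < x by rewrite gt_max ax ltrBlDr ltrDl.
suff lN : `]l, x[ `<=` N.
  have : (mu `]l, x[ <= mu N)%E by apply: le_measure; rewrite ?inE.
  by rewrite N0 lebesgue_measure_itv /= lte_fin lx -EFinD lee_fin; lra.
move=> y /=; rewrite in_itv /= gt_max => /andP[/andP[ay dy] yx].
apply: sub => /= H.
have xdy : ball x d y by rewrite /ball /= ger0_norm; lra.
have := dP y xdy; rewrite (H _) ?ltxx//.
by rewrite ay (lt_trans yx xb).
Qed.

Lemma oriented_integral_ae0 a h : L1_loc a h -> a <= 0 ->
  {ae mu, forall s, a < s -> oriented_integral h 0 s = 0} ->
  {ae mu, forall s, a < s -> h s = 0}.
Proof.
move=> Hh a0 H0.
have step (n : nat) : {ae mu, forall s, a < s < n.+1%:R -> h s = 0}.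
  pose hT := h \_ `]a, n.+1%:R[.
  have ihT : mu.-integrable setT (EFin \o hT) by exact: L1_loc_patch.
  have Hc : {ae mu, forall s, a < s < n.+1%:R -> prim hT s = prim hT 0}.
    move: H0; apply: ae_imply => s H /andP[ps sT]; move: (H ps).
    rewrite (@oriented_integral_prim a n.+1%:R)// ?(ltW ps)//.
    by move=> /eqP; rewrite subr_eq0 => /eqP.
  have := prim_constant_ae0 ihT (ae_eq_continuous (prim_continuous ihT) Hc).
  apply: ae_imply => s hs sI; rewrite -(hs sI) /hT patchE mem_setE in_itv /=.
  by rewrite sI.
have := ae_all step; apply: ae_imply => s H ps.
apply: (H (Num.truncn `|s|)); rewrite ps /=.
by apply: le_lt_trans (ler_norm s) _; exact: truncnS_gt.
Qed.

Lemma Rintegral_shift h (c x : R) : mu.-integrable setT (EFin \o h) ->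
  \int[mu]_(y in `]0, x]) h (c + y) = \int[mu]_(y in `]c, c + x]) h y.
Proof.
move=> ih; rewrite [LHS]Rintegral_mkcond [RHS]Rintegral_mkcond.
rewrite -[RHS](preserves_Rintegral (shift_preserves c)); last first.
  by apply: integrable_patch => //; exact: integrableS ih.
congr Rintegral; apply/funext => y; rewrite !patchE !mem_setE !in_itv /=.
by rewrite ltrDl lerD2l.
Qed.

Lemma Rintegral_reflect h (c x : R) : mu.-integrable setT (EFin \o h) ->
  \int[mu]_(y in `]0, x]) h (c - y) = \int[mu]_(y in `]c - x, c]) h y.
Proof.
move=> ih; rewrite [LHS]Rintegral_mkcond.
rewrite [RHS]Rintegral_itv_obnd_cbnd; last exact: integrableS ih.
rewrite -[RHS]Rintegral_itv_bndo_bndc; last exact: integrableS ih.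
rewrite [RHS]Rintegral_mkcond.
rewrite -[RHS](preserves_Rintegral (reflect_preserves c)); last first.
  by apply: integrable_patch => //; exact: integrableS ih.
congr Rintegral; apply/funext => y; rewrite !patchE !mem_setE !in_itv /=.
by rewrite lerD2l lerN2 gtrBl andbC.
Qed.

End OrientedIntegral.

(** * Profiles of solutions *)

Section OpenIntervalIntegrals.
Context (R : realType).
Local Notation mu := (@lebesgue_measure R).
Context (H : R -> \bar R) (mH : measurable_fun setT H).
Hypothesis H_ge0 : forall x, (0 <= H x)%E.

Lemma ge0_integral_oo_split (a b c : R) : a <= b -> b <= c ->
  (\int[mu]_(x in `]a, c[) H x =
   \int[mu]_(x in `]a, b[) H x + \int[mu]_(x in `]b, c[) H x)%E.
Proof.
move=> ab bc.
rewrite [X in _ = (X + _)%E]integral_itv_bndo_bndc; last exact: measurable_funTS.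
have [cb|bltc] := leP c b.
  have -> : c = b by apply/le_anti; rewrite cb bc.
  have -> : `]b, b[%classic = set0 :> set R by rewrite set_itv_ge ?bnd_simp ?ltxx.
  rewrite integral_set0 adde0.
  by rewrite [LHS]integral_itv_bndo_bndc//; exact: measurable_funTS.
rewrite -ge0_integral_setU//.
- congr integral; apply/seteqP; split => x /=; rewrite !in_itv /=.
    by move=> /andP[ax xc]; case: (leP x b) => xb; [left|right]; rewrite ?ax ?xc.
  by move=> [/andP[-> xb]|/andP[bx ->]];
    rewrite ?(le_lt_trans xb bltc) ?(le_lt_trans ab bx).
- exact: measurable_funTS.
- apply/disj_setPS => x [] /=; rewrite !in_itv /= => /andP[_ xb] /andP[bx _].
  by move: (le_lt_trans xb bx); rewrite ltxx.
Qed.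

Lemma ge0_integral_oo_shift (a b c : R) :
  (\int[mu]_(x in `]a, b[) H (c + x) =
   \int[mu]_(x in `](c + a)%R, (c + b)%R[) H x)%E.
Proof.
rewrite [LHS]integral_mkcond [RHS]integral_mkcond.
rewrite -[RHS](preserves_ge0_integral (shift_preserves c)).
- congr integral; apply/funext => y; rewrite !patchE !mem_setE !in_itv /=.
  by rewrite !ltrD2l.
- by apply/(measurable_restrictT _ _).1 => //; exact: measurable_funTS.
- by move=> x; rewrite patchE; case: ifPn.
Qed.

Lemma ge0_integral_oo_reflect (a b c : R) :
  (\int[mu]_(x in `]a, b[) H (c - x) =
   \int[mu]_(x in `](c - b)%R, (c - a)%R[) H x)%E.
Proof.
rewrite [LHS]integral_mkcond [RHS]integral_mkcond.
rewrite -[RHS](preserves_ge0_integral (reflect_preserves c)).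
- congr integral; apply/funext => y; rewrite !patchE !mem_setE !in_itv /=.
  by rewrite !ltrD2l !ltrN2 andbC.
- by apply/(measurable_restrictT _ _).1 => //; exact: measurable_funTS.
- by move=> x; rewrite patchE; case: ifPn.
Qed.

End OpenIntervalIntegrals.

Section Profiles.
Context (R : realType) (p : \bar R).
Hypothesis p_ge1 : (1 <= p)%E.
Local Notation mu := (@lebesgue_measure R).
Implicit Types (f g : R -> R) (z : R -> R -> R).

Let s2 : R := Num.sqrt 2.

Let s2_gt0 : 0 < s2. Proof. by rewrite sqrtr_gt0. Qed.

Let s2s2 : s2 * s2 = 2. Proof. by rewrite -expr2 sqr_sqrtr. Qed.

Lemma oriented_integral00 f : oriented_integral f 0 0 = 0.
Proof. by rewrite /oriented_integral lexx set_itv1 Rintegral_set1. Qed.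

(** A d'Alembert representation determines its profiles: the difference of two
    representations is 2-periodic and vanishes on one period. *)
Lemma profiles_unique z f g f' g' :
  wave_profiles p z f g -> wave_profiles p z f' g' ->
  {ae mu, forall s, 0 < s -> f s = f' s} /\
  {ae mu, forall s, -1 < s -> g s = g' s}.
Proof.
move=> [Lf Lg zE] [Lf' Lg' zE'].
have Hf := Lp_loc_L1_loc p_ge1 Lf; have Hf' := Lp_loc_L1_loc p_ge1 Lf'.
have Hg := Lp_loc_L1_loc p_ge1 Lg; have Hg' := Lp_loc_L1_loc p_ge1 Lg'.
pose D s := oriented_integral f 0 s - oriented_integral f' 0 s.
pose E s := oriented_integral g 0 s - oriented_integral g' 0 s.
have DE t x : 0 <= t -> 0 <= x <= 1 -> D (t + x) + E (t - x) = 0.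
  move=> t0 x01; have := zE t x t0 x01; rewrite (zE' t x t0 x01) -!mulrDr.
  by move=> /mulfI => /(_ (invr_neq0 (lt0r_neq0 s2_gt0))); rewrite /D /E; lra.
have D0 : D 0 = 0 by rewrite /D !oriented_integral00 subrr.
have E0 : E 0 = 0 by rewrite /E !oriented_integral00 subrr.
have Dn (n : nat) s : 0 <= s <= n%:R -> D s = 0.
  elim: n s => [|n IH] s /andP[s0 sn].
    by have -> : s = 0 by apply/le_anti; rewrite sn s0.
  have [s2'|s2'] := leP s 2.
    have := @DE (s / 2) (s / 2); rewrite subrr E0 addr0 -splitr; apply; lra.
  have h1 : D s + E (s - 2) = 0.
    have := @DE (s - 1) 1; rewrite subrK.
    have -> : s - 1 - 1 = s - 2 by ring.
    by apply; lra.
  have h2 : D (s - 2) + E (s - 2) = 0.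
    by have := @DE (s - 2) 0; rewrite addr0 subr0; apply; lra.
  have h3 : D (s - 2) = 0 by apply: IH; move: sn; rewrite -natr1; lra.
  lra.
have Ds s : 0 <= s -> D s = 0.
  move=> s0; apply: (Dn (Num.truncn s).+1); rewrite s0 /=.
  by apply/ltW; exact: truncnS_gt.
have Es s : -1 <= s -> E s = 0.
  move=> s1; have [s0|s0] := leP 0 s.
    have := @DE s 0; rewrite addr0 subr0 Ds// add0r; apply; lra.
  have := @DE 0 (- s); rewrite !add0r opprK Ds ?add0r; [|lra].
  by apply; lra.
split.
- have := @oriented_integral_ae0 _ 0 (f \- f') (L1_locB Hf Hf') (lexx 0).
  suff H : {ae mu, forall s, 0 < s -> oriented_integral (f \- f') 0 s = 0}.
    move=> /(_ H); apply: ae_imply => s /= + s0 => /(_ s0) /eqP.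
    by rewrite subr_eq0 => /eqP.
  apply: aeW => s s0; rewrite (oriented_integralB Hf Hf' (lexx 0) (ltW s0)).
  exact: Ds (ltW s0).
- have m10 : -1 <= 0 :> R by lra.
  have := @oriented_integral_ae0 _ (-1) (g \- g') (L1_locB Hg Hg') m10.
  suff H : {ae mu, forall s, -1 < s -> oriented_integral (g \- g') 0 s = 0}.
    move=> /(_ H); apply: ae_imply => s /= + s0 => /(_ s0) /eqP.
    by rewrite subr_eq0 => /eqP.
  apply: aeW => s s0; rewrite (oriented_integralB Hg Hg' m10 (ltW s0)).
  exact: Es (ltW s0).
Qed.

(** At the fixed end the two travelling waves cancel. *)
Lemma profiles_reflection z f g : wave_profiles p z f g ->
  {ae mu, forall t, 0 <= t -> z t 0 = 0} ->
  {ae mu, forall s, 0 < s -> f s = - g s}.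
Proof.
move=> [Lf Lg zE] z0.
have Hf := Lp_loc_L1_loc p_ge1 Lf.
have Hg : L1_loc 0 g by apply: (L1_locS _ (Lp_loc_L1_loc p_ge1 Lg)); lra.
have := oriented_integral_ae0 (L1_locD Hf Hg) (lexx 0).
suff H : {ae mu, forall s, 0 < s -> oriented_integral (f \+ g) 0 s = 0}.
  move=> /(_ H); apply: ae_imply => s /= + s0 => /(_ s0) /eqP.
  by rewrite addr_eq0 => /eqP.
move: z0; apply: ae_imply => s zs s0; have := zs (ltW s0).
rewrite zE ?(ltW s0) ?lexx ?ler01// addr0 subr0 -mulrDr.
rewrite -(oriented_integralD Hf Hg (lexx 0) (ltW s0)) => /eqP.
by rewrite mulf_eq0 invr_eq0 (gt_eqF s2_gt0) => /eqP.
Qed.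

(** [z t] is the primitive of the difference of a translate of [f] and a reflected
    translate of [g]. *)
Lemma profile_weak_derivative z f g (t : R) : wave_profiles p z f g -> 0 <= t ->
  exists2 w, is_weak_derivative (z t) w &
    forall x, 0 < x < 1 -> w x = dx_of_profiles f g t x.
Proof.
move=> [Lf Lg zE] t0.
have Hf := Lp_loc_L1_loc p_ge1 Lf; have Hg := Lp_loc_L1_loc p_ge1 Lg.
(* Any bound above [t + 1] truncates harmlessly. *)
pose T := t + 2; pose f1 := f \_ `]0, T[; pose g1 := g \_ `]-1, T[.
have if1 : mu.-integrable setT (EFin \o f1) by exact: L1_loc_patch.
have ig1 : mu.-integrable setT (EFin \o g1) by exact: L1_loc_patch.
have ift := preserves_integrable (shift_preserves t) if1.
have igt := preserves_integrable (reflect_preserves t) ig1.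
pose w x := s2^-1 * (f1 (t + x) - g1 (t - x)).
have ifg : mu.-integrable setT (EFin \o (fun x => f1 (t + x) - g1 (t - x))).
  by have := integrableB _ ift igt; apply.
have iw : mu.-integrable setT (EFin \o w).
  by have := integrableZl _ s2^-1 ifg; apply.
have T0 : 0 < T by rewrite /T; lra.
exists w; last first.
  move=> x /andP[x0 x1]; rewrite /w /dx_of_profiles mulrC /f1 /g1 !patchE.
  rewrite !mem_setE !in_itv /= ifT; last by rewrite /T; apply/andP; split; lra.
  by rewrite ifT// /T; apply/andP; split; lra.
apply: (@prim_is_weak_derivative _ _ _ (z t 0 - prim w 0) iw) => x /andP[x0 x1].
have -> : z t 0 - prim w 0 + prim w x = z t 0 + (prim w x - prim w 0) by ring.
rewrite primB ?ltW// RintegralZl//; last exact: integrableS ifg.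
rewrite RintegralB//; [|exact: integrableS ift|exact: integrableS igt].
rewrite Rintegral_shift// Rintegral_reflect//.
rewrite -!primB//; [|lra|lra].
rewrite !zE//; [|lra|lra].
have or_f s : 0 <= s < T -> oriented_integral f 0 s = prim f1 s - prim f1 0.
  exact: oriented_integral_prim.
have or_g s : -1 <= s < T -> oriented_integral g 0 s = prim g1 s - prim g1 0.
  by apply: oriented_integral_prim => //; lra.
rewrite !or_f ?or_g ?addr0 ?subr0; [ring|rewrite /T; lra..].
Qed.

End Profiles.

(** * The energy as a norm on a sliding window *)

Section SlidingWindow.
Context (R : realType) (p : \bar R).
Hypothesis p_ge1 : (1 <= p)%E.
Local Notation mu := (@lebesgue_measure R).
Context (g : R -> R) (mg : measurable_fun setT g).

Lemma ae_neq (c : R) : {ae mu, forall x, x <> c}.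
Proof.
exists [set c]; split => //; first exact: lebesgue_measure_set1.
by move=> x /= /contrapT ->.
Qed.

Let mgr (r : R) : measurable_fun setT (fun x => (`|g x| `^ r)%:E).
Proof. exact: measurable_norm_powR. Qed.

Let gr_ge0 (r : R) x : (0 <= (`|g x| `^ r)%:E)%E.
Proof. by rewrite lee_fin powR_ge0. Qed.

Lemma Lp_norm_shift (a b c : R) :
  Lp_norm `](c + a), (c + b)[ p g = Lp_norm `]a, b[ p (fun x => g (c + x)).
Proof.
case: p p_ge1 => [r| |]//= r1.
  rewrite lee_fin in r1.
  rewrite (Lp_normE _ r1 (measurable_itv _)) (Lp_normE _ r1 (measurable_itv _)).
  by rewrite -(ge0_integral_oo_shift (mgr r) (gr_ge0 r)).
apply/le_anti/andP; split.
  apply: (Lp_norm_oo_le _ _ (Lp_norm_ge0 _ _ _)).2.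
  have := (Lp_norm_oo_le `]a, b[ (fun x => g (c + x))
    (Lp_norm_ge0 _ +oo _)).1 (lexx _).
  move=> /(preserves_ae (shift_preserves (- c))); apply: ae_imply => x /=.
  rewrite addrA subrr add0r !in_itv /= => H /andP[ax xb]; apply: H.
  by apply/andP; split; lra.
apply: (Lp_norm_oo_le _ _ (Lp_norm_ge0 _ _ _)).2.
have := (Lp_norm_oo_le `](c + a), (c + b)[ g (Lp_norm_ge0 _ +oo _)).1 (lexx _).
move=> /(preserves_ae (shift_preserves c)); apply: ae_imply => x /=.
by rewrite !in_itv /= !ltrD2l.
Qed.

(** What leaves the window on the left re-enters it on the right, one period
    later and damped. *)
Lemma Lp_norm_slide (t t' : R) : t <= t' -> t' <= t + 2 ->
  {ae mu, forall s, t - 1 < s < t' - 1 -> `|g (2 + s)| <= `|g s|} ->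
  (Lp_norm `](t' - 1)%R, (t' + 1)%R[ p g <=
   Lp_norm `](t - 1)%R, (t + 1)%R[ p g)%E.
Proof.
move=> tt' t't gs; case: p p_ge1 => [r| |]//= r1.
  rewrite lee_fin in r1; rewrite !(Lp_normE _ r1 (measurable_itv _)).
  have r0 : 0 <= r^-1 by rewrite invr_ge0; lra.
  have int0 D : (0 <= \int[mu]_(x in D) (`|g x| `^ r)%:E)%E.
    exact: integral_ge0.
  apply: (gt0_ler_poweR r0); [by rewrite in_itv /= leey int0..|].
  rewrite (@ge0_integral_oo_split _ _ (mgr r) (gr_ge0 r) (t' - 1) (t + 1));
    [|lra..].
  rewrite [leRHS](@ge0_integral_oo_split _ _ (mgr r) (gr_ge0 r) _ (t' - 1));
    [|lra..].
  rewrite addeC; apply: leeD => //.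
  have -> : t + 1 = 2 + (t - 1) by ring.
  have -> : t' + 1 = 2 + (t' - 1) by ring.
  rewrite -(ge0_integral_oo_shift (mgr r) (gr_ge0 r)).
  apply: ae_ge0_le_integral => //.
  - apply: measurable_funTS; apply: measurable_norm_powR => //.
    by apply: measurableT_comp => //; case: (shift_preserves (2 : R)).
  - by apply: measurable_funTS; exact: mgr.
  - move: gs; apply: ae_imply => x gx; rewrite /= in_itv /= => xI.
    by rewrite lee_fin; apply: ge0_ler_powR; rewrite ?nnegrE//; [lra|exact: gx].
apply: (Lp_norm_oo_le _ _ (Lp_norm_ge0 _ _ _)).2.
set K := Lp_norm _ _ _.
have K0 : (0 <= K)%E by exact: Lp_norm_ge0.
have HK := (Lp_norm_oo_le `](t - 1), (t + 1)[ g K0).1 (lexx _).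
have := ae_and gs HK => /(preserves_ae (shift_preserves (- 2))).
move=> /(ae_and HK) /(ae_and (ae_neq (t + 1))).
apply: ae_imply => x /= [xt [Hx [+ Hx2]]]; rewrite !in_itv /= in Hx Hx2 *.
rewrite addrA subrr add0r => gx /andP[x1 x2].
have [xlt|tx] := ltP x (t + 1); first by apply: Hx; apply/andP; split; lra.
have {}tx : t + 1 < x by rewrite lt_neqAle tx andbT eq_sym; exact/eqP.
apply: le_trans (Hx2 _); last by apply/andP; split; lra.
by rewrite lee_fin; apply: gx; apply/andP; split; lra.
Qed.

End SlidingWindow.

Section Energy.
Context (R : realType) (p : \bar R).
Hypothesis p_ge1 : (1 <= p)%E.
Local Notation mu := (@lebesgue_measure R).
Implicit Types (f g : R -> R) (z : R -> R -> R).

Let s2 : R := Num.sqrt 2.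

Let s2_gt0 : 0 < s2. Proof. by rewrite sqrtr_gt0. Qed.

Let s2s2 : s2 * s2 = 2. Proof. by rewrite -expr2 sqr_sqrtr. Qed.

(** The two characteristics through [(t, x)], for [x] in [(0, 1)], sweep the
    window [(t - 1, t + 1)] once. *)
Lemma Xp_norm_window (g u v : R -> R) (t : R) : measurable_fun setT g ->
  measurable_fun (`]0, 1[ : set R) (weak_derivative u) ->
  measurable_fun (`]0, 1[ : set R) v ->
  {ae mu, forall x, 0 < x < 1 ->
    `|weak_derivative u x + v x| = s2 * `|g (t + x)| /\
    `|weak_derivative u x - v x| = s2 * `|g (t - x)|} ->
  Xp_norm p u v = Lp_norm `](t - 1), (t + 1)[ p g.
Proof.
move=> mg mdu mv H; rewrite /Xp_norm; set du := weak_derivative u in mdu H *.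
have mshift : measurable_fun setT (fun x : R => g (t + x)).
  by apply: measurableT_comp => //; case: (shift_preserves t).
have mrefl : measurable_fun setT (fun x : R => g (t - x)).
  by apply: measurableT_comp => //; case: (reflect_preserves t).
case: p p_ge1 => [r| |]//= r1.
  rewrite lee_fin in r1; rewrite Lp_normE//; congr poweR.
  have mgr : measurable_fun setT (fun x => (`|g x| `^ r)%:E).
    exact: measurable_norm_powR.
  have gr0 x : (0 <= (`|g x| `^ r)%:E)%E by rewrite lee_fin powR_ge0.
  transitivity ((2 `^ (- (r / 2)))%:E *
    \int[mu]_(x in `]0%R, 1%R[) ((s2 `^ r)%:E *
       ((`|g (t + x)| `^ r)%:E + (`|g (t - x)| `^ r)%:E)))%E.
    congr (_ * _)%E; apply: ge0_ae_eq_integral => //.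
    - apply/measurable_EFinP; apply: measurable_funD; apply/measurable_EFinP;
        apply: measurable_norm_powR => //.
        exact: measurable_funD.
      exact: measurable_funB.
    - apply: emeasurable_funM => //; apply: emeasurable_funD.
        by apply: measurable_funTS; exact: measurable_norm_powR.
      by apply: measurable_funTS; exact: measurable_norm_powR.
    - by move=> x _; rewrite mule_ge0 ?adde_ge0 ?lee_fin ?powR_ge0.
    - move: H; apply: ae_imply => x H; rewrite /= in_itv /= => /H[-> ->].
      by rewrite !powRM ?(ltW s2_gt0)// -mulrDr EFinM EFinD.
  rewrite ge0_integralZl ?lee_fin ?powR_ge0//; last 2 first.
  - apply: emeasurable_funD.
      by apply: measurable_funTS; exact: measurable_norm_powR.
    by apply: measurable_funTS; exact: measurable_norm_powR.
  - by move=> x _; rewrite adde_ge0 ?lee_fin ?powR_ge0.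
  rewrite muleA -EFinM.
  have -> : 2 `^ (- (r / 2)) * s2 `^ r = 1.
    rewrite /s2 -powR12_sqrt// -powRrM -powRD; last by rewrite pnatr_eq0 implybT.
    by rewrite [2^-1 * r]mulrC addNr powRr0.
  rewrite mul1e ge0_integralD//; last 2 first.
  - by apply: measurable_funTS; exact: measurable_norm_powR.
  - by apply: measurable_funTS; exact: measurable_norm_powR.
  rewrite (ge0_integral_oo_shift mgr gr0) (ge0_integral_oo_reflect mgr gr0).
  rewrite addr0 subr0 addeC -(ge0_integral_oo_split mgr gr0)//; lra.
have m2 : (0 <= (s2^-1)%:E)%E by rewrite lee_fin invr_ge0 ltW.
set N1 := Lp_norm _ _ (du \+ v); set N2 := Lp_norm _ _ (du \- v).
have N10 : (0 <= N1)%E by exact: Lp_norm_ge0.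
have N20 : (0 <= N2)%E by exact: Lp_norm_ge0.
apply/le_anti/andP; split.
  set K := Lp_norm _ _ _.
  have K0 : (0 <= K)%E by exact: Lp_norm_ge0.
  have HK := (Lp_norm_oo_le `](t - 1), (t + 1)[ g K0).1 (lexx _).
  have sK : (0 <= s2%:E * K)%E by rewrite mule_ge0// lee_fin ltW.
  have -> : K = ((s2^-1)%:E * (s2%:E * K))%E.
    by rewrite muleA -EFinM mulVf ?mul1e// lt0r_neq0.
  apply: lee_wpmul2l => //; rewrite ge_max; apply/andP; split.
  - apply: (Lp_norm_oo_le _ _ sK).2.
    have := ae_and H (preserves_ae (shift_preserves t) HK).
    apply: ae_imply => x /= [Hx gx]; rewrite !in_itv /= in gx *.
    move=> x01; have [-> _] := Hx x01; rewrite EFinM.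
    apply: lee_wpmul2l; first by rewrite lee_fin ltW.
    by apply: gx; apply/andP; split; lra.
  - apply: (Lp_norm_oo_le _ _ sK).2.
    have := ae_and H (preserves_ae (reflect_preserves t) HK).
    apply: ae_imply => x /= [Hx gx]; rewrite !in_itv /= in gx *.
    move=> x01; have [_ ->] := Hx x01; rewrite EFinM.
    apply: lee_wpmul2l; first by rewrite lee_fin ltW.
    by apply: gx; apply/andP; split; lra.
set K := (_ * maxe N1 N2)%E.
have K0 : (0 <= K)%E by rewrite mule_ge0// le_max N10.
apply: (Lp_norm_oo_le _ _ K0).2.
have H1 := (Lp_norm_oo_le `]0, 1[ (du \+ v) N10).1 (lexx _).
have H2 := (Lp_norm_oo_le `]0, 1[ (du \- v) N20).1 (lexx _).
have A1 := preserves_ae (shift_preserves (- t)) (ae_and H H1).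
have A2 := preserves_ae (reflect_preserves t) (ae_and H H2).
have := ae_and (ae_neq t) (ae_and A1 A2).
apply: ae_imply => s /= [st [[B1 C1] [B2 C2]]]; rewrite !in_itv /= in C1 C2 *.
move=> /andP[s1 s3].
have -> : (`|g s|%:E = (s2^-1)%:E * (s2 * `|g s|)%:E)%E.
  by rewrite -EFinM mulrA mulVf ?mul1r// lt0r_neq0.
apply: lee_wpmul2l => //; rewrite le_max.
have [slt|tle] := ltP s t; apply/orP.
- right; have I : 0 < t - s < 1 by apply/andP; split; lra.
  have [_] := B2 I.
  by rewrite (_ : t - (t - s) = s); [move=> <-; exact: C2|ring].
- left; have {}tle : t < s by rewrite lt_neqAle tle andbT eq_sym; exact/eqP.
  have I : 0 < - t + s < 1 by apply/andP; split; lra.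
  have [+ _] := B1 I.
  by rewrite (_ : t + (- t + s) = s); [move=> <-; exact: C1|ring].
Qed.

(** The energy is defined through some weak derivative and some profiles; they
    agree almost everywhere with those at hand, and on positive arguments [f] is
    [- g], so that the energy only depends on the modulus of [g]. *)
Lemma energy_window z f g (t : R) : wave_profiles p z f g ->
  {ae mu, forall t, 0 <= t -> z t 0 = 0} -> 0 <= t ->
  energy p z t = Lp_norm `](t - 1), (t + 1)[ p (g \_ `]-1, +oo[).
Proof.
move=> zfg z0 t0; rewrite /energy.
have fg := profiles_reflection p_ge1 zfg z0.
rewrite /time_derivative.
set fg' := xget _ _.
have : [set fg : (R -> R) * (R -> R) | wave_profiles p z fg.1 fg.2] fg'.
  by rewrite /fg'; apply: xgetPex; exists (f, g).
move: fg' => [f' g'] /= zfg'.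
have [ff' gg'] := profiles_unique p_ge1 zfg zfg'.
have [w wz wE] := profile_weak_derivative p_ge1 zfg t0.
have wdz : is_weak_derivative (z t) (weak_derivative (z t)).
  by rewrite /weak_derivative; apply: xgetPex; exists w.
have wd_w := weak_derivative_unique wdz wz.
have [[mf' _] [mg' _] _] := zfg'; have [_ [mg _] _] := zfg.
have pt := shift_preserves t; have qt := reflect_preserves t.
apply: Xp_norm_window.
- exact/(measurable_restrictT _ _).1.
- by case: wdz => _ [].
- have mf1 : measurable_fun setT (f' \_ `]0, +oo[).
    exact/(measurable_restrictT _ _).1.
  have mg1 : measurable_fun setT (g' \_ `]-1, +oo[).
    exact/(measurable_restrictT _ _).1.
  apply: (eq_measurable_fun (fun x =>
    ((f' \_ `]0, +oo[) (t + x) + (g' \_ `]-1, +oo[) (t - x)) / s2)).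
    move=> x; rewrite inE /= in_itv /= => /andP[x0 x1].
    rewrite /dt_of_profiles !patchE !mem_setE !in_itv /= !andbT.
    by rewrite ifT; [rewrite ifT//; lra|lra].
  apply: measurable_funM => //; apply: measurable_funD.
    by apply: measurable_funTS; apply: measurableT_comp => //; case: pt.
  by apply: measurable_funTS; apply: measurableT_comp => //; case: qt.
- have A1 := preserves_ae pt (ae_and ff' fg).
  have A2 := preserves_ae qt gg'.
  have := ae_and wd_w (ae_and A1 A2); apply: ae_imply => x [W [[F1 F2] G]].
  move=> x01; have /andP[x0 x1] := x01.
  rewrite (W x01) (wE x x01) /dx_of_profiles /dt_of_profiles.
  rewrite -F1 ?F2 -?G; [|lra..].
  rewrite !patchE !mem_setE !in_itv /= !andbT ifT; last by lra.
  rewrite ifT; last by lra.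
  have s2N0 : s2 != 0 by rewrite lt0r_neq0.
  have e2 : 2 / s2 = s2 by rewrite -s2s2 mulfK.
  have key y : `|- (2 * y) / s2| = s2 * `|y|.
    by rewrite mulNr mulrAC e2 normrN normrM gtr0_norm.
  rewrite -mulrDl -mulrBl -!key; split; congr (`|_ / _|); ring.
Qed.

End Energy.

(** * Two-sided bounds of the window norms *)

Section WindowAsymptotics.
Context (R : realType) (Q : R -> R) (QP : decay_map Q) (N l : R).
Hypothesis N_gt0 : 0 < N.
Hypothesis l_gt0 : 0 < l.
Hypothesis l_lt1 : l < 1.
Context (p : \bar R).
Hypothesis p_ge1 : (1 <= p)%E.
Local Notation mu := (@lebesgue_measure R).
Context (g : R -> R) (mg : measurable_fun setT g).
Hypothesis g_step :
  {ae mu, forall s, -1 < s -> decay_step Q N l `|g s| `|g (2 + s)|}.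
Let J := (`]-1, 1[%classic : set R).
Let mI : measurable J. Proof. exact: measurable_itv. Qed.
Hypothesis g_fin : (Lp_norm J p g < +oo)%E.

Local Notation b n := (iter n Q 1).

(** The window of the energy at time [2 n], brought back to the reference period
    [(-1, 1)]. *)
Definition even_window (n : nat) (s : R) : R := g (n%:R * 2 + s).

Lemma g_orbit : {ae mu, forall s, -1 < s ->
  forall n, decay_step Q N l `|even_window n s| `|even_window n.+1 s|}.
Proof.
have st n := preserves_ae (shift_preserves (n%:R * 2 : R)) g_step.
have := ae_all st; apply: ae_imply => s H s1 n.
have := H n; rewrite /even_window addrA.
have -> : n.+1%:R * 2 + s = 2 + n%:R * 2 + s by rewrite -natr1; ring.
by apply; have : 0 <= n%:R :> R by []; lra.
Qed.

Lemma g_nonincreasing : {ae mu, forall s, -1 < s -> `|g (2 + s)| <= `|g s|}.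
Proof.
move: g_step; apply: ae_imply => s H s1.
by apply: (decay_step_le QP l_lt1 _ (H s1)).
Qed.

Lemma even_window_measurable n : measurable_fun setT (even_window n).
Proof.
apply: measurableT_comp => //.
by case: (shift_preserves (n%:R * 2 : R)).
Qed.

Lemma Lp_norm_even_window n :
  Lp_norm `](n%:R * 2 - 1), (n%:R * 2 + 1)[ p g = Lp_norm J p (even_window n).
Proof. by rewrite /even_window -(Lp_norm_shift p_ge1 mg). Qed.

Lemma window_monotone (t t' : R) : 0 <= t -> t <= t' -> t' <= t + 2 ->
  (Lp_norm `](t' - 1)%R, (t' + 1)%R[ p g <=
   Lp_norm `](t - 1)%R, (t + 1)%R[ p g)%E.
Proof.
move=> t0 tt' t't; apply: Lp_norm_slide => //.
by move: g_nonincreasing; apply: ae_imply => s + /andP[s1 _]; apply; lra.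
Qed.

Lemma Lp_norm_one_lty : (Lp_norm J p (cst 1%R) < +oo)%E.
Proof.
case: p p_ge1 => [r| |]//= r1.
  rewrite lee_fin in r1; rewrite (Lp_normE _ r1 (measurable_itv _)).
  apply: poweR_lty; under eq_integral do rewrite normr1 powR1.
  by rewrite integral_cst// mul1e; exact: lebesgue_oo_lty.
apply: (@le_lt_trans _ _ 1%E); last exact: ltry.
by apply: (Lp_norm_oo_le _ _ _).2 => //; apply: aeW => x _; rewrite normr1.
Qed.

(** The pointwise bound of the orbits is linear in their starting point, so it
    integrates to a bound by the norm of [1 + `|g|]. *)
Lemma window_upper : exists2 C, 0 < C &
  forall n, (Lp_norm J p (even_window n) <= (C * b n)%:E)%E.
Proof.
have [C C0 CP] := orbit_upper QP N_gt0 l_gt0 l_lt1.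
pose k s := 1 + `|g s|.
have mk : measurable_fun setT k.
  by apply: measurable_funD => //; exact: measurableT_comp.
have kfin : (Lp_norm J p k < +oo)%E.
  apply: (@le_lt_trans _ _
    (Lp_norm J p (cst 1%R) + Lp_norm J p (fun s => `|g s|)%R)%E).
    apply: Lp_norm_triangle => //.
    by apply: measurable_funTS; exact: measurableT_comp.
  apply: lte_add_pinfty; first exact: Lp_norm_one_lty.
  apply: le_lt_trans g_fin; apply: le_Lp_norm => //.
  - by apply: measurable_funTS; exact: measurableT_comp.
  - exact: measurable_funTS.
  - by apply: aeW => x _; rewrite /= normr_id.
pose K := fine (Lp_norm J p k).
have KE : Lp_norm J p k = K%:E.
  by rewrite fineK// ge0_fin_numE// Lp_norm_ge0.
have K0 : 0 <= K by rewrite -lee_fin -KE Lp_norm_ge0.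
exists (C * (K + 1)) => [|n]; first by rewrite mulr_gt0//; lra.
have b0 : 0 < b n by apply: iterQ_gt0.
have Cb : 0 < C * b n by rewrite mulr_gt0.
apply: (@le_trans _ _ (Lp_norm J p (fun s => C * b n * k s))).
  apply: le_Lp_norm => //.
  - by apply: measurable_funTS; exact: even_window_measurable.
  - by apply: measurable_funTS; exact: measurable_funM.
  - move: g_orbit; apply: ae_imply => s H; rewrite /J /= in_itv /= => /andP[s1 _].
    have := CP _ (fun n => normr_ge0 _) (H s1) n.
    rewrite /even_window mul0r add0r => /le_trans; apply.
    by rewrite ler_norm.
rewrite Lp_normZ//; last exact: measurable_funTS.
rewrite KE -EFinM lee_fin; nra.
Qed.

Hypothesis g_neq0 : ~ {ae mu, forall s, -1 < s < 1 -> g s = 0}.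

(** Almost every nonzero orbit ends up in the range where [Q] governs it, so a
    set of positive measure does so at a common time with a common lower bound. *)
Lemma positive_core : exists2 A : set R, measurable A /\ A `<=` J &
  (0 < mu A)%E /\ exists2 c, 0 < c &
    {ae mu, forall s, A s -> forall n, c * b n <= `|even_window n s|}.
Proof.
pose A (k j : nat) : set R :=
  J `&` even_window k @^-1` [set y | (j.+1%:R^-1 <= `|y|) && (`|y| < N)].
have mA k j : measurable (A k j).
  have mw : measurable_fun J (even_window k).
    by apply: measurable_funTS; exact: even_window_measurable.
  apply: mw => //; rewrite (_ : [set _ | _] =
      (fun y : R => `|y|) @^-1` (`[j.+1%:R^-1, N[%classic : set R)); last first.
    by apply/seteqP; split => y /=; rewrite in_itv.
  rewrite -[X in measurable X]setTI.
  by apply: normr_measurable.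
have [[k [j kj]]|none] := pselect (exists k j, mu (A k j) != 0); last first.
  exfalso; apply: g_neq0.
  have all0 k j : {ae mu, forall s, ~ A k j s}.
    exists (A k j); split; [exact: mA| |by move=> x /= /contrapT].
    by apply: contrapT => H; apply: none; exists k, j; apply/eqP.
  have := ae_and g_orbit (ae_all (fun k => ae_all (all0 k))).
  apply: ae_imply => s [orb H] /andP[s1 s2].
  apply: contrapT => /eqP gs.
  have orb' := orb s1.
  have [k kN] := orbit_below N_gt0 l_gt0 l_lt1 (fun n => normr_ge0 _) orb'.
  have hpos n : 0 < `|even_window n s|.
    elim: n => [|n IH]; last by case: (orb' n) => _ _; exact.
    by rewrite /even_window mul0r add0r normr_gt0.
  have [j _ /(_ j (leqnn j)) jk] := near_infty_natSinv_lt (PosNum (hpos k)).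
  by apply: (H k j); split; [rewrite /J /= in_itv /= s1|rewrite /= kN ltW].
have e0 : 0 < j.+1%:R^-1 :> R by rewrite invr_gt0.
have [c c0 cP] := orbit_lower QP N l_lt1 e0.
exists (A k j); first by split => //; exact: subIsetl.
split; first by rewrite lt_neqAle eq_sym kj measure_ge0.
exists c => //; move: g_orbit; apply: ae_imply => s orb [Is /andP[ks sN]] n.
have s1 : -1 < s by move: Is; rewrite /J /= in_itv /= => /andP[].
exact: (cP _ (fun n => normr_ge0 _) (orb s1) k).
Qed.

Lemma window_lower : exists2 C, 0 < C &
  forall n, ((C * b n)%:E <= Lp_norm J p (even_window n))%E.
Proof.
have [A [mA AI] [A0 [c c0 cP]]] := positive_core.
have mind D : measurable_fun D (\1_A : R -> R) by exact: measurable_funTS.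
pose K := Lp_norm J p (\1_A : R -> R).
have Kfin : (K < +oo)%E.
  apply: le_lt_trans Lp_norm_one_lty; apply: le_Lp_norm => //.
  apply: aeW => x _; rewrite /= indicE normr1 ger0_norm//.
  by case: (x \in A).
have K0 : (0 < K)%E.
  rewrite lt_neqAle Lp_norm_ge0 andbT eq_sym; apply/eqP => KE.
  have mIA : measurable_fun setT (EFin \o ((\1_A : R -> R) \_ J)).
    by apply/measurable_EFinP/(measurable_restrictT _ _).1.
  have := @Lnorm_eq0_eq0 _ _ _ (@lebesgue_measure R) _ _ mIA
    (lt_le_trans lte01 p_ge1) KE.
  move=> [X [mX X0 sub]]; have : (mu A <= mu X)%E.
    apply: le_measure; rewrite ?inE// => x Ax; apply: sub => /= H.
    have /eqP := H I; rewrite patchE mem_set; last exact: AI.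
    by rewrite indicE mem_set// eqe oner_eq0.
  by rewrite X0 leNgt A0.
exists (c * fine K) => [|n]; first by rewrite mulr_gt0// fine_gt0// K0.
have b0 : 0 < b n by apply: iterQ_gt0.
apply: (@le_trans _ _ (Lp_norm J p (fun s => c * b n * \1_A s))).
  rewrite Lp_normZ//; last by rewrite mulr_gt0.
  have KE : K = (fine K)%:E by rewrite fineK// ge0_fin_numE// ltW.
  by rewrite -/K [X in (_ <= _ * X)%E]KE -EFinM lee_fin mulrAC.
apply: le_Lp_norm => //.
- by apply: measurable_funM.
- by apply: measurable_funTS; exact: even_window_measurable.
- move: cP; apply: ae_imply => s H _; rewrite indicE.
  case: (boolP (s \in A)) => [/set_mem As|_] /=; rewrite ?mulr0 ?normr0// mulr1.
  by rewrite gtr0_norm ?H// mulr_gt0.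
Qed.

(** By monotonicity only even times have to be compared; the lower bound uses the
    next even time, at the price of one step of the reference orbit. *)
Lemma window_asymptotics : exists C1 C2 : R, [/\ 0 < C1, 0 < C2 &
  forall t : R, 0 <= t ->
    ((C1 * b (Num.truncn (t / 2)))%:E <=
      Lp_norm `](t - 1)%R, (t + 1)%R[ p g)%E /\
    (Lp_norm `](t - 1)%R, (t + 1)%R[ p g <=
      (C2 * b (Num.truncn (t / 2)))%:E)%E].
Proof.
have [C2 C20 C2P] := window_upper.
have [C1 C10 C1P] := window_lower.
have [c c0 cP] := iterQ_next QP.
exists (C1 * c), C2; split => //; first by rewrite mulr_gt0.
move=> t t0; set n := Num.truncn (t / 2).
have /andP[nt tn] : n%:R <= t / 2 < n.+1%:R.
  by apply: truncn_itv; rewrite divr_ge0.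
have n0 : 0 <= n%:R :> R by [].
clearbody n; rewrite -[n.+1%:R]natr1 in tn; split.
- apply: (@le_trans _ _ (C1 * b n.+1)%:E).
    by rewrite lee_fin -mulrA ler_pM2l.
  apply: le_trans (C1P n.+1) _; rewrite -Lp_norm_even_window.
  by apply: window_monotone; rewrite // -[n.+1%:R]natr1; lra.
- apply: le_trans (C2P n); rewrite -Lp_norm_even_window.
  by apply: window_monotone; lra.
Qed.

End WindowAsymptotics.

(** * Nontrivial solutions and the decay rate *)

Section Vanishing.
Context (R : realType).
Local Notation mu := (@lebesgue_measure R).

Lemma oriented_integral_eq0 (a s : R) (f : R -> R) : L1_loc a f -> a <= 0 ->
  {ae mu, forall x, a < x -> f x = 0} -> a <= s -> oriented_integral f 0 s = 0.
Proof.
move=> Hf a0 f0 ps; pose T := Num.max s 0 + 1.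
have T0 : 0 < T by rewrite ltr_pwDr// le_max lexx orbT.
have sT : a <= s < T by rewrite ps ltr_pwDr// le_max lexx.
rewrite (oriented_integral_prim Hf a0 T0 sT).
have ifT := L1_loc_patch T Hf.
have prim0 x : prim (f \_ `]a, T[) x = 0.
  rewrite /prim /Rintegral.
  rewrite (@ae_eq_integral _ _ _ (@lebesgue_measure R) _ (cst 0%E))//.
  - by rewrite integral0.
  - by apply: measurable_funTS; case/integrableP: ifT.
  - move: f0; apply: ae_imply => y fy _ /=; rewrite patchE mem_setE in_itv /=.
    by case: ifPn => // /andP[/fy ->].
by rewrite !prim0 subrr.
Qed.

(** Induction on the periods; the points that separate them are negligible. *)
Lemma ae_vanish_propagates (g : R -> R) :
  {ae mu, forall s, -1 < s -> `|g (2 + s)| <= `|g s|} ->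
  {ae mu, forall s, -1 < s < 1 -> g s = 0} ->
  {ae mu, forall s, -1 < s -> g s = 0}.
Proof.
move=> dec g0.
have step (n : nat) : {ae mu, forall s, -1 < s < n%:R * 2 + 1 -> g s = 0}.
  elim: n => [|n IH]; first by rewrite mul0r add0r.
  have := ae_and (ae_neq (n%:R * 2 + 1))
    (ae_and IH (preserves_ae (shift_preserves (- 2)) (ae_and dec IH))).
  apply: ae_imply => s [sn [near [far gs]]] /andP[s1 s2].
  rewrite -[n.+1%:R]natr1 in s2.
  have [slt|nles] := ltP s (n%:R * 2 + 1); first by apply: near; rewrite s1.
  have nlts : n%:R * 2 + 1 < s by rewrite lt_neqAle nles andbT eq_sym; exact/eqP.
  have n0 : 0 <= n%:R :> R by [].
  have := far _; rewrite (_ : 2 + (- 2 + s) = s); last by ring.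
  rewrite gs; last by apply/andP; split; lra.
  by rewrite normr0 normr_le0 => H; apply/eqP/H; lra.
have := ae_all step; apply: ae_imply => s H s1.
apply: (H (Num.truncn (`|s|)).+1); rewrite s1 /=.
have := truncnS_gt `|s|; have := ler_norm s.
move: (_.+1%:R) => m; have := normr_ge0 s; lra.
Qed.

End Vanishing.

Theorem corollary54 (R : realType) (Sigma : set (R * R)) (M a b : R)
  (Sigma_damping : damping_set Sigma)
  (M_gt0 : 0 < M) (a_gt0 : 0 < a) (b_gt0 : 0 < b)
  (Sigma_sector : forall x y : R, Sigma (x, y) -> ~ euclidean_ball M (x, y) ->
     a * `|x| <= `|y| <= b * `|x|)
  (Sigma_diag : Sigma `&` [set w : R * R | w.1 = w.2] = [set (0, 0)])
  (q dq : R -> R)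
  (q_C1 : C1_half_line q dq)
  (q_ge0 : forall x : R, 0 <= x -> 0 <= q x)
  (q0 : q 0 = 0) (dq0 : dq 0 = 0)
  (q_lt : forall x : R, 0 < x -> 0 < q x < x)
  (dq_lt1 : forall x : R, 0 < x -> `|dq x| < 1)
  (Sigma_q : forall x y : R, Sigma (x, y) -> euclidean_ball M (x, y) ->
     `|y| = q `|x| \/ `|x| = q `|y|)
  (p : \bar R) (p_ge1 : (1 <= p)%E)
  (z0 z1 : R -> R) (z01_Xp : Xp p z0 z1)
  (z : R -> R -> R) (z_sol : wave_solution Sigma p z0 z1 z)
  (z_nontrivial : nontrivial z) :
  exists C1 C2 : R, [/\ 0 < C1, 0 < C2 &
    forall t : R, 0 <= t ->
      ((C1 * iter (Num.truncn (t / 2)) (Qmap q) 1)%:E <= energy p z t)%E /\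
      (energy p z t <= (C2 * iter (Num.truncn (t / 2)) (Qmap q) 1)%:E)%E].
Proof.
have [_ Sigma_sign _] := Sigma_damping.
have QP := Qmap_decay_map q_C1 q_ge0 q0 dq0 q_lt dq_lt1.
have [l /andP[l0 l1] Sstep] := Sigma_decay_step Sigma_sign M_gt0 a_gt0 b_gt0
  Sigma_sector Sigma_diag q_C1 q_ge0 q0 q_lt dq_lt1 Sigma_q.
have s2_gt0 : 0 < Num.sqrt 2 :> R by rewrite sqrtr_gt0.
have N0 : 0 < M / Num.sqrt 2 by rewrite divr_gt0.
have [f [g [zfg bdry _]]] := z_sol.
have z_end : {ae (@lebesgue_measure R), forall t, 0 <= t -> z t 0 = 0}.
  by move: bdry; apply: ae_imply => t H /H[].
have [Lf Lg zE] := zfg.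
pose G := g \_ `]-1, +oo[.
have GE s : -1 < s -> G s = g s.
  by move=> s1; rewrite /G patchE mem_setE in_itv /= s1.
have mG : measurable_fun setT G.
  by apply/(measurable_restrictT _ _).1 => //; case: Lg.
have fg := profiles_reflection p_ge1 zfg z_end.
have G_step : {ae (@lebesgue_measure R), forall s, -1 < s ->
    decay_step (Qmap q) (M / Num.sqrt 2) l `|G s| `|G (2 + s)|}.
  have := ae_and (preserves_ae (shift_preserves 1) bdry)
    (preserves_ae (shift_preserves 2) fg).
  apply: ae_imply => s [H fgs] s1.
  have [_ /Sstep] := H (ltac:(lra)).
  rewrite /dt_of_profiles /dx_of_profiles.
  have -> : 1 + s + 1 = 2 + s by ring.
  have -> : 1 + s - 1 = s by ring.
  rewrite fgs; last by lra.
  rewrite -!GE//; last by lra.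
  have half (y : R) : `|(y * 2) / Num.sqrt 2| / Num.sqrt 2 = `|y|.
    rewrite !normrM normfV (gtr0_norm s2_gt0) (ger0_norm (ler0n _ 2)).
    rewrite (_ : `|y| * 2 = `|y| * Num.sqrt 2 * Num.sqrt 2).
      by rewrite !mulfK// lt0r_neq0.
    by rewrite -mulrA -expr2 sqr_sqrtr.
  set A := (X in decay_step _ _ _ X _); set B := (X in decay_step _ _ _ _ X).
  have AE : A = `|G s|.
    rewrite /A -[RHS]half; congr (`|_| / _); rewrite -mulNr -mulrDl.
    by congr (_ / _); ring.
  have BE : B = `|G (2 + s)|.
    rewrite /B -[RHS]half; congr (`|_| / _); rewrite -mulNr -mulrBl.
    by congr (_ / _); ring.
  by rewrite AE BE.
have G_fin : (Lp_norm `](-1)%R, 1%R[ p G < +oo)%E.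
  have [_] := Lg; have m11 : -1 < 1 :> R by lra.
  move=> /(_ 1 m11)[_]; apply: le_lt_trans.
  have mI : measurable (`]-1, 1[%classic : set R) by exact: measurable_itv.
  have mg : measurable_fun (`]-1, 1[ : set R) g.
    apply: measurable_funS (proj1 Lg) => // x /=.
    by rewrite !in_itv /= andbT => /andP[].
  apply: le_Lp_norm => //; first exact: measurable_funTS.
  apply: aeW => s; rewrite /= in_itv /= => /andP[s1 _].
  by rewrite GE.
have G_neq0 : ~ {ae (@lebesgue_measure R), forall s, -1 < s < 1 -> G s = 0}.
  move=> /(ae_vanish_propagates (g_nonincreasing QP l1 G_step)) G0.
  have Hf := Lp_loc_L1_loc p_ge1 Lf; have Hg := Lp_loc_L1_loc p_ge1 Lg.
  have g0 : {ae (@lebesgue_measure R), forall s, -1 < s -> g s = 0}.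
    by move: G0; apply: ae_imply => s H s1; rewrite -GE// H.
  have f0 : {ae (@lebesgue_measure R), forall s, 0 < s -> f s = 0}.
    have := ae_and g0 fg; apply: ae_imply => s [gs fs] s0.
    by rewrite fs// gs ?oppr0//; lra.
  have [t [x [t0 x01 /eqP]]] := z_nontrivial; apply; rewrite zE//.
  have /andP[x0 x1] := x01.
  rewrite (oriented_integral_eq0 Hf (lexx 0) f0) ?addr_ge0//.
  by rewrite (oriented_integral_eq0 Hg _ g0) ?mulr0 ?addr0//; lra.
have [C1 [C2 [C10 C20 H]]] :=
  window_asymptotics QP N0 l0 l1 p_ge1 mG G_step G_fin G_neq0.
exists C1, C2; split => // t t0.
by rewrite (energy_window p_ge1 zfg z_end t0); exact: H.
Qed.
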